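(* Let $(X,\nu)$ be a standard Borel space with a non-atomic finite non-negative measure $\nu$, and let $P_\Gamma=P_\Gamma(\nu)$ be the gamma measure. For each $a\in\mathcal{M}$, the measure $P_\Gamma$ is quasi-invariant under $M_a$ (i.e. the image measure $M_aP_\Gamma$ is equivalent to $P_\Gamma$), and the corresponding density is $$\frac{d(M_aP_\Gamma)}{dP_\Gamma}(\eta)=\exp\left(-\int_X\log a(x)\,d\nu(x)\right)\cdot\exp\left(-\int_X\tilde a(x)\,d\eta(x)\right),$$ where $\tilde a(x)=\frac1{a(x)}-1$.
   Context: $D$ is the space of finite real discrete measures $\sum z_i\delta_{x_i}$ ($x_i\in X$, $\sum|z_i|<\infty$) on $X$, $D^+\subset D$ the cone of finite positive discrete measures, with the $\sigma$-algebra generated by $\eta\mapsto\eta(A)$, $A\subset X$ Borel. The gamma measure $P_\Gamma=P_\Gamma(\nu)$ is the law on $D$ (concentrated on $D^+$) determined by $$\mathbb{E}_\Gamma\left[\exp\left(-\int_X a\,d\eta\right)\right]=\exp\left(-\int_X\log(1+a(x))\,d\nu(x)\right)$$ for every non-negative bounded Borel function $a$ on $X$ (it is the law of the Lévy process on $(X,\nu)$ with Lévy measure $z^{-1}e^{-z}dz$, $z>0$). $\mathcal{M}=\{a:X\to\mathbb{R}_+ : \int_X|\log a(x)|\,d\nu(x)<\infty\}$ is the set of (classes mod $0$ of) non-negative measurable functions with $\nu$-summable logarithm. For $a\in\mathcal{M}$, the multiplicator $M_a$ is $M_a\eta=\sum a(x_i)z_i\delta_{x_i}$ for $\eta=\sum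 z_i\delta_{x_i}$ (defined $P_\Gamma$-almost everywhere). *)

(* Defs.v *)
From HB Require Import structures.
From mathcomp Require Import all_boot all_order all_algebra.
From mathcomp Require Import all_classical all_reals all_analysis.
From mathcomp Require Import measurable_realfun.
Import Order.TTheory GRing.Theory Num.Theory.
Import numFieldNormedType.Exports.

Set Implicit Arguments.
Unset Strict Implicit.
Unset Printing Implicit Defensive.

Local Open Scope classical_set_scope.
Local Open Scope ring_scope.
Local Open Scope ereal_scope.

(* X is Borel isomorphic to a Polish space. *)
Definition standard_borel (R : realType) d (X : measurableType d) : Prop :=
  exists (T : completePseudoMetricType R) (f : X -> T),
    [/\ hausdorff_space T,
        exists2 S : set T, countable S & dense S,
        bijective f &
        forall A : set X, measurable A <-> <<s [set O : set T | open O] >> (f @` A)].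

Definition atom d (X : measurableType d) (R : realType)
    (nu : set X -> \bar R) (A : set X) : Prop :=
  [/\ measurable A, 0 < nu A &
      forall B, measurable B -> B `<=` A -> nu B < nu A -> nu B = 0].

Definition nonatomic d (X : measurableType d) (R : realType)
    (nu : set X -> \bar R) : Prop :=
  forall A, ~ atom nu A.

(* Unordered sum of a family of reals of arbitrary sign. It is the usual sum
   when the family is absolutely summable over A; the library's convention is
   +oo - +oo = -oo. *)
Definition rsum (R : realType) (X : choiceType) (A : set X) (g : X -> R) : \bar R :=
  \esum_(x in A) (EFin \o g)^\+ x - \esum_(x in A) (EFin \o g)^\- x.

(* A finite real discrete measure eta = \sum_i z_i \delta_(x_i) with distinct
   points x_i is encoded by its mass function x |-> eta {x}. Absolute
   summability forces the support to be countable. *)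
Record dmeasure (R : realType) (X : choiceType) := DMeasure {
  mass : X -> R ;
  mass_summable : summable [set: X] (EFin \o mass) }.

Section dmeasure_theory.
Context {R : realType} {X : choiceType}.
Implicit Type eta : dmeasure R X.

Definition deval eta (A : set X) : \bar R := rsum A (mass eta).

Definition dint eta (f : X -> R) : \bar R :=
  rsum [set: X] (fun x => f x * mass eta x)%R.

Definition dpositive : set (dmeasure R X) :=
  [set eta | forall x, (0 <= mass eta x)%R].

Lemma dzero_summable : summable [set: X] (EFin \o (fun=> 0%R : R)).
Proof. by rewrite /summable esum1 ?ltry// => x _ /=; rewrite normr0. Qed.

Definition dzero : dmeasure R X := DMeasure dzero_summable.

Definition multdom (a : X -> R) : set (dmeasure R X) :=
  [set eta | summable [set: X] (EFin \o (fun x => a x * mass eta x)%R)].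

(* Total extension of the multiplicator: the value 0 is used off multdom a. *)
Definition mult (a : X -> R) eta : dmeasure R X :=
  match pselect (multdom a eta) with
  | left s => DMeasure s
  | right _ => dzero
  end.

End dmeasure_theory.

Section dmeasure_measurable.
Context d (X : measurableType d) (R : realType).

HB.instance Definition _ := gen_eqMixin (dmeasure R X).
HB.instance Definition _ := gen_choiceMixin (dmeasure R X).
HB.instance Definition _ := isPointed.Build (dmeasure R X) dzero.

(* The sigma-algebra generated by the maps eta |-> eta A, A measurable. *)
Definition dmeasure_measurable : set (set (dmeasure R X)) :=
  <<s \bigcup_(A in (measurable : set (set X)))
        preimage_set_system [set: dmeasure R X] (deval ^~ A)
          measurable >>.

Definition dmeasure_display : measure_display.
Proof. by constructor. Qed.

HB.instance Definition _ :=
  @isMeasurable.Build dmeasure_display (dmeasure R X) dmeasure_measurable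
    (@sigma_algebra0 _ setT _) (@sigma_algebraC _ _)
    (@sigma_algebra_bigcup _ setT _).

End dmeasure_measurable.

Section gamma.
Context d (X : measurableType d) (R : realType).
Variable nu : {measure set X -> \bar R}.

Definition gamma_measure (P : probability (dmeasure R X) R) : Prop :=
  {ae P, forall eta, dpositive eta} /\
  forall a : X -> R,
    measurable_fun [set: X] a ->
    (forall x, (0 <= a x)%R) ->
    (exists M : R, forall x, (a x <= M)%R) ->
    \int[P]_eta expeR (- dint eta a) =
      expeR (- \int[nu]_x (ln (1 + a x))%:E).

(* Since lne 0 = -oo, integrability of lne \o a forces a > 0 almost
   everywhere. *)
Definition log_summable (a : X -> R) : Prop :=
  [/\ measurable_fun [set: X] a,
      forall x, (0 <= a x)%R &
      nu.-integrable [set: X] (fun x => lne (a x)%:E)].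

(* Where a x = 0 this takes the value -1. For log_summable a this happens only
   on a nu-null set, which has eta-mass 0 for almost every eta under the gamma
   measure. *)
Definition tilde (a : X -> R) : X -> R := fun x => ((a x)^-1 - 1)%R.

Definition mult_density (a : X -> R) (eta : dmeasure R X) : \bar R :=
  expeR (- \int[nu]_x lne (a x)%:E) * expeR (- dint eta (tilde a)).

End gamma.

Definition has_density d (T : measurableType d) (R : realType)
    (Q : set T -> \bar R) (P : {measure set T -> \bar R}) (f : T -> \bar R)
    : Prop :=
  [/\ measurable_fun [set: T] f,
      forall t, 0 <= f t &
      forall B, measurable B -> Q B = \int[P]_(t in B) f t].

(* Main.v *)
Require Import Defs.
From HB Require Import structures.
From mathcomp Require Import all_boot all_order all_algebra.
From mathcomp Require Import all_classical all_reals all_analysis.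
From mathcomp Require Import measurable_realfun.
From mathcomp Require Import ring lra.
Import Order.TTheory GRing.Theory Num.Theory.
Import numFieldNormedType.Exports.

Set Implicit Arguments.
Unset Strict Implicit.
Unset Printing Implicit Defensive.

Local Open Scope classical_set_scope.
Local Open Scope ring_scope.
Local Open Scope ereal_scope.

(** The gamma measure is characterized by its Laplace transform, and rescaling
    the masses by a changes this transform in the same way as tilting by the
    asserted density. Indeed the image of P under the multiplicator has at f the
    transform E exp (- \int f a d eta) = exp (- \int log (1 + f a) d nu), while
    the tilted measure has
    exp (- \int log a d nu) E exp (- \int (f + 1/a - 1) d eta)
      = exp (- \int log a d nu - \int log (f + 1/a) d nu),
    and the two agree because 1 + f a = a (f + 1/a). Three points need an
    argument.

    Uniqueness ([laplace_unique]). The exponentials exp (- eta A) take values in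
    the unit interval, and a Laplace transform at f multiplied by a monomial in
    exp (- eta A) is a Laplace transform at another function. Explicit
    polynomials converge boundedly to the indicator of the event y < eta A
    ([cvg_step]), so that two measures with the same transform agree on finite
    intersections of such events, which form a generating pi-system.

    Negative test functions ([laplace_tilde]). When a > 1 the function
    f + 1/a - 1 can be negative and the definition of the gamma measure says
    nothing about it. For a <= 1 there is no difficulty ([laplace_tilde_le1]),
    so the theorem holds for multiplicators bounded by 1. Applying it to the
    multiplicator by 1 / max (a, 1) yields the transform at f + 1/a - 1 in
    general.

    Measurability. A discrete measure may be signed, and the sigma-algebra only
    makes the evaluations at measurable sets measurable. In a standard Borel
    space the positive part of eta is a supremum of countably many evaluations
    ([ppart_coded]), which makes integrals, the multiplicator and the density
    measurable.

    Finally the density is almost surely positive because the integral of 1/a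
    against eta is almost surely finite ([ae_dint_lty]), which gives the
    equivalence of the two measures. *)

(** * Countable separation in standard Borel spaces *)

Definition separating (T : Type) (E : nat -> set T) : Prop :=
  forall x y, x <> y -> exists n, ~ (E n x <-> E n y).

(** The interiors of the balls of radius 2/(k+1) around a countable dense set
    separate the points of a Hausdorff pseudometric space. The balls around the
    centers with the same number n are united into one set, which lets the
    family be indexed by pairs of natural numbers without choosing an inverse
    of the numbering. *)
Lemma standard_borel_separating (R : realType) d (X : measurableType d) :
  standard_borel R X ->
  exists E : nat -> set X, (forall n, measurable (E n)) /\ separating E.
Proof.
move=> [T [f [hT [S cS dS] bf mX]]].
have /countable_injP[g ginj] := cS.
pose U (s : T) (k : nat) : set T := interior (ball s (2 * k.+1%:R^-1)%R).
pose E0 (n k : nat) : set X := f @^-1` \bigcup_(s in [set s | S s /\ g s = n]) U s k.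
pose E (n : nat) : set X :=
  if unpickle n is Some p then E0 p.1 p.2 else set0.
exists E; split.
  move=> n; rewrite /E; case: unpickle => [p|]; last exact: measurable0.
  apply/mX; apply: sub_sigma_algebra => /=.
  rewrite /E0 image_preimage; last first.
    by apply/seteqP; split => // y _; case: bf => h fh hf; exists (h y).
  by apply: bigcup_open => s _; exact: open_interior.
move=> x y xy.
have fxy : f x != f y by apply/eqP => /(bij_inj bf).
move: hT; rewrite ball_hausdorff => /(_ _ _ fxy) [[r s] /= rs].
set e := Num.min r%:num s%:num.
have e0 : (0 < e / 4)%R by rewrite divr_gt0// lt_min !gt0.
have [k ke] : exists k : nat, (k.+1%:R^-1 < e / 4)%R.
  by have [k _ /(_ k (leqnn _)) ?] := near_infty_natSinv_lt (PosNum e0); exists k.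
have k0 : (0 < k.+1%:R^-1 :> R)%R by rewrite invr_gt0.
have [s0 [xs0 Ss0]] : exists s0, interior (ball (f x) (k.+1%:R^-1)%R) s0 /\ S s0.
  have /dS : interior (ball (f x) (k.+1%:R^-1)%R) !=set0.
    by exists (f x); apply: nbhsx_ballx.
  by move=> /(_ (@open_interior _ _))[s0 [? ?]]; exists s0.
have {}xs0 : ball (f x) k.+1%:R^-1 s0 by exact: interior_subset.
exists (pickle (g s0, k)); rewrite /E pickleK /= /E0 /=.
have Ex : (\bigcup_(s in [set s | S s /\ g s = g s0]) U s k) (f x).
  exists s0 => //; rewrite /U; apply/nbhs_ballP; exists k.+1%:R^-1%R => //= z xz.
  by rewrite mulrDl !mul1r; apply: ball_triangle xz; exact: ball_sym.
move=> [/(_ Ex) [s1 [Ss1 gs1]] + _].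
have <- : s0 = s1 by apply: ginj => //; rewrite inE.
move=> /interior_subset sy.
move/eqP: rs; apply/eqP/set0P; exists (f y); split; last exact: ballxx.
apply: (@le_ball _ _ _ (k.+1%:R^-1 + 2 * k.+1%:R^-1)%R); last first.
  exact: ball_triangle sy.
rewrite (@le_trans _ _ e)//; last by rewrite ge_min lexx.
have -> : (e = 4 * (e / 4))%R by rewrite mulrCA divff ?mulr1.
rewrite (@le_trans _ _ (4 * k.+1%:R^-1)%R)//; last by rewrite ler_wpM2l// ltW.
rewrite -[X in (X + _)%R]mul1r -mulrDl ler_wpM2r ?invr_ge0//.
by rewrite -[1%R]/(1%:R)%R -natrD ler_nat.
Qed.

(** * Positive and negative parts of a discrete measure *)

Lemma esumZl (R : realType) (T : choiceType) (I : set T) (a : T -> \bar R) (c : R) :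
  (0 <= c)%R -> (forall x, 0 <= a x) ->
  \esum_(x in I) (c%:E * a x) = c%:E * \esum_(x in I) a x.
Proof.
have le b (e : R) : (0 < e)%R -> (forall x, 0 <= b x) ->
    \esum_(x in I) (e%:E * b x) <= e%:E * \esum_(x in I) b x.
  move=> e0 b0; apply: ge_ereal_sup => _ [F [finF FI] <-].
  rewrite -ge0_mule_fsumr// lee_pmul2l//.
  by apply: esum_ge; exists F.
rewrite le_eqVlt => /predU1P[<- _|c0 a0].
  by rewrite mul0e esum1// => x _; rewrite mul0e.
apply/eqP; rewrite eq_le le//= -lee_pdivlMl//.
have := le (fun x => c%:E * a x) c^-1%R.
rewrite invr_gt0 => /(_ c0); under eq_esum do rewrite muleA -EFinM mulVf ?gt_eqF// mul1e.
by apply=> x; rewrite mule_ge0// lee_fin ltW.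
Qed.

Section positive_part.
Context (R : realType) d (X : measurableType d).
Implicit Types g h : X -> R.

(** The positive part, in the sense of Jordan, of the discrete measure with
    masses g; its negative part is [ppart (\- g)]. *)
Definition ppart g (A : set X) : \bar R := \esum_(x in A) (Num.max (g x) 0)%:E.

Let ppart0 g : ppart g set0 = 0. Proof. exact: esum_set0. Qed.

Let ppart_ge0 g A : 0 <= ppart g A.
Proof. by apply: esum_ge0 => x _; rewrite lee_fin le_max lexx orbT. Qed.

Let ppart_sigma_additive g : semi_sigma_additive (ppart g).
Proof.
move=> F mF tF mUF; rewrite /ppart nneseries_sum_bigcup//; last first.
  by move=> x; rewrite lee_fin le_max lexx orbT.
by apply: is_cvg_ereal_nneg_natsum => n _; exact: ppart_ge0.
Qed.

HB.instance Definition _ g := isMeasure.Build _ _ _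
  (ppart g) (ppart0 g) (ppart_ge0 g) (@ppart_sigma_additive g).

Lemma rsumE A g : rsum A g = ppart g A - ppart (\- g)%R A.
Proof.
rewrite /rsum /ppart; congr (_ - _); apply: eq_esum => x _.
  by rewrite funeposE /= EFin_max.
by rewrite funenegE /= EFin_max.
Qed.

Lemma summableE_ppart g :
  \esum_(x in [set: X]) `|(g x)%:E| = ppart g setT + ppart (\- g)%R setT.
Proof.
rewrite /ppart -esumD//; try by move=> x _; rewrite lee_fin le_max lexx orbT.
apply: eq_esum => x _; rewrite -EFinD /=; congr (_%:E).
have [g0|/ltW g0] := leP 0%R (g x).
  have ng : (- g x <= 0)%R by rewrite oppr_le0.
  by rewrite ger0_norm// (max_r ng) addr0.
have ng : (0 <= - g x)%R by rewrite oppr_ge0.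
by rewrite ler0_norm// (max_l ng) add0r.
Qed.

Lemma summable_ppart g : summable [set: X] (EFin \o g) ->
  ppart g setT < +oo /\ ppart (\- g)%R setT < +oo.
Proof.
rewrite /summable summableE_ppart => gs.
by split; apply: le_lt_trans gs; rewrite ?leeDl ?leeDr.
Qed.

Import HBNNSimple.

(** Both sides are monotone limits along simple functions, and for a simple
    function the identity is the exchange of a finite sum with an unordered
    sum. *)
Lemma integral_ppart g (f : X -> \bar R) : measurable_fun [set: X] f ->
  (forall x, 0 <= f x) ->
  \int[ppart g]_x f x = \esum_(x in [set: X]) (f x * (Num.max (g x) 0)%:E).
Proof.
move=> mf f0; pose f_ := nnsfun_approx measurableT mf.
have g0 x : 0 <= (Num.max (g x) 0)%:E by rewrite lee_fin le_max lexx orbT.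
have simple (h : {nnsfun X >-> R}) :
    \int[ppart g]_x (h x)%:E = \esum_(x in setT) ((h x)%:E * (Num.max (g x) 0)%:E).
  under eq_integral do rewrite fimfunE -fsumEFin//.
  rewrite ge0_integral_fsum//; last 2 first.
    - by move=> r; exact/measurable_EFinP/measurableT_comp.
    - by move=> r x _; rewrite EFinM nnfun_muleindic_ge0.
  rewrite fsbig_finite//=.
  under eq_esum => x _.
    rewrite fimfunE -fsumEFin// ge0_mule_fsuml; last first.
      by move=> r; rewrite EFinM nnfun_muleindic_ge0.
    rewrite fsbig_finite//=; over.
  rewrite esum_sum; last first.
    by move=> x r _ _; rewrite mule_ge0// EFinM nnfun_muleindic_ge0.
  apply: eq_bigr => r _; rewrite integralZl_indic_nnsfun// integral_indic// setIT.
  have [r0|r0] := ltP r 0%R.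
    rewrite preimage_nnfun0// measure0 mule0 esum1// => x _.
    by rewrite indic0 mulr0 mul0e.
  rewrite /= /ppart [in LHS]esum_mkcond -esumZl//; last by move=> x; case: ifP.
  apply: eq_esum => x _.
  by rewrite indicE EFinM -muleA; case: ifPn => _; rewrite ?mul1e ?mul0e.
transitivity (limn (fun n => \int[ppart g]_x (f_ n x)%:E)).
  rewrite -monotone_convergence//.
  - by apply: eq_integral => x _; apply/esym/cvg_lim => //; exact: cvg_nnsfun_approx.
  - by move=> n; exact/measurable_EFinP.
  - by move=> n x _; rewrite lee_fin.
  - by move=> x _ m n mn; rewrite lee_fin; exact/lefP/nd_nnsfun_approx.
under eq_fun do rewrite simple.
have nd m n : (m <= n)%N -> \esum_(x in setT) ((f_ m x)%:E * (Num.max (g x) 0)%:E) <=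
    \esum_(x in setT) ((f_ n x)%:E * (Num.max (g x) 0)%:E).
  move=> mn; apply: le_esum => x _; rewrite lee_wpmul2r// lee_fin.
  exact/lefP/nd_nnsfun_approx.
have cvg_nd := ereal_nondecreasing_is_cvgn nd.
apply/eqP; rewrite eq_le; apply/andP; split.
  apply: lime_le => //; near=> n; apply: le_esum => x _; rewrite lee_wpmul2r//.
  by rewrite /f_ nnsfun_approxE; apply: le_approx.
apply: ge_ereal_sup => _ [F [finF FT] <-].
have cvgF : (fun n => \sum_(x \in F) ((f_ n x)%:E * (Num.max (g x) 0)%:E)) @ \oo -->
    \sum_(x \in F) (f x * (Num.max (g x) 0)%:E).
  rewrite fsbig_finite//; under eq_fun do rewrite fsbig_finite//.
  apply: cvg_nnesum => x _; first by near=> n; rewrite mule_ge0// lee_fin.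
  by apply: cvgeZr => //; exact: cvg_nnsfun_approx.
rewrite -(cvg_lim _ cvgF)//; apply: lee_lim => //.
  by apply/cvg_ex; eexists; exact: cvgF.
by near=> n; apply: esum_ge; exists F.
Unshelve. all: by end_near.
Qed.

Lemma integral_ppart_fin g (f : X -> R) : measurable_fun [set: X] f ->
  (forall x, (0 <= f x)%R) ->
  \int[ppart g]_x (f x)%:E = ppart (f \* g)%R setT.
Proof.
move=> mf f0; rewrite integral_ppart//; last first.
  exact/measurable_EFinP.
apply: eq_esum => x _; rewrite -EFinM /=.
by rewrite maxr_pMr// mulr0.
Qed.

End positive_part.

Section coding.
Context d (X : measurableType d) (E : nat -> set X).

Definition bits n (x : X) : seq bool := mkseq (fun i => `[< E i x >]) n.

(** The sets [coded p] are the members of the algebra generated by E. Encoding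
    them by a length and a list of bit strings makes this family visibly
    countable. *)
Definition coded (p : nat * seq (seq bool)) : set X :=
  [set x | bits p.1 x \in p.2].

Lemma measurable_coded p : (forall n, measurable (E n)) -> measurable (coded p).
Proof.
move=> mE; case: p => n; elim=> [|l L ih].
  by rewrite (_ : coded _ = set0)//; apply/seteqP; split.
rewrite (_ : coded _ = [set x | bits n x = l] `|` coded (n, L)); last first.
  apply/seteqP; split=> x; rewrite /coded /= in_cons.
    by case/orP => [/eqP|]; [left|right].
  by case=> [->|->]; rewrite ?eqxx ?orbT.
apply: measurableU => //.
rewrite (_ : [set x | _] = [set x | size l = n] `&`
    \bigcap_(i in `I_n) (if nth false l i then E i else ~` E i)); last first.
  apply/seteqP; split=> x /=.
    move=> <-; split; first by rewrite size_mkseq.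
    by move=> i /= lein; rewrite nth_mkseq//; case: asboolP.
  move=> [sl] h; apply: (@eq_from_nth _ false).
    by rewrite size_mkseq.
  move=> i; rewrite size_mkseq => lein; rewrite nth_mkseq//.
  have /= := h i lein.
  by case: nth => [Ei|nEi]; [apply/asboolP|apply/asboolP].
apply: measurableI.
  have [sl|sl] := pselect (size l = n).
    by rewrite (_ : [set x | _] = setT)//; apply/seteqP; split.
  by rewrite (_ : [set x | _] = set0)//; apply/seteqP; split.
apply: bigcap_measurableType => i _.
by case: ifP => _ //; exact: measurableC.
Qed.

Lemma bits_separate (s : seq (X * X)) : separating E -> exists n,
  forall p, p \in s -> bits n p.1 = bits n p.2 -> p.1 = p.2.
Proof.
move=> sE.
have incr m n x y : (m <= n)%N -> bits n x = bits n y -> bits m x = bits m y.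
  move=> mn xy; apply: (@eq_from_nth _ false); rewrite !size_mkseq// => i im.
  have := congr1 (fun z => nth false z i) xy.
  by rewrite !nth_mkseq// (leq_trans im).
elim: s => [|[x y] s [n ih]]; first by exists 0%N.
have [m xy] : exists m, bits m x = bits m y -> x = y.
  have [->|/sE[k Exy]] := pselect (x = y); first by exists 0%N.
  exists k.+1 => /(congr1 (fun z => nth false z k)).
  by rewrite !nth_mkseq// => Ek; case: Exy; exact: asbool_eq_equiv.
exists (maxn m n) => p; rewrite in_cons => /predU1P[->/= h|ps h].
  by apply: xy; apply: incr h; rewrite leq_maxl.
by apply: ih => //; apply: incr h; rewrite leq_maxr.
Qed.

End coding.

Section jordan.
Context (R : realType) d (X : measurableType d).
Implicit Types (g : X -> R) (eta : dmeasure R X).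

Lemma ppart_le g A B : A `<=` B -> ppart g A <= ppart g B.
Proof.
move=> AB; apply: ge_ereal_sup => _ [F [finF FA] <-].
by apply: esum_ge; exists F => //; split=> //; exact: subset_trans AB.
Qed.

Lemma fsbig_ppart g F : \sum_(x \in F) (Num.max (g x) 0)%:E =
  \sum_(x \in F `&` [set x | (0 < g x)%R]) (Num.max (g x) 0)%:E.
Proof.
apply/esym/fsbig_widen; first exact: subIsetl.
move=> x [Fx] /= nx; congr (_%:E); apply/max_idPr.
by rewrite leNgt; apply/negP => gx; apply: nx.
Qed.

Lemma deval_le eta A B : A `<=` B -> deval eta A <= ppart (mass eta) B.
Proof.
move=> AB; rewrite /deval rsumE.
by apply: le_trans (ppart_le _ AB); rewrite geeDl// oppe_le0.
Qed.

(** Since eta restricted to A `&` C has at most the mass of the positive part,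
    only the lower bound has content. Given a finite set F of points with
    positive mass and a finite set G that carries the negative part up to e,
    some member C of the countable algebra contains F and misses the other
    points of G, because finitely many digits distinguish the points of F and
    G. Then eta (A `&` C) is at least the mass of F minus e. This is
    where the standard Borel structure enters: it turns the positive part, hence
    every integral below, into a measurable function of eta. *)
Lemma ppart_coded eta (E : nat -> set X) (A : set X) : separating E ->
  ppart (mass eta) A =
  ereal_sup (range (fun p => deval eta (A `&` coded E p))).
Proof.
move=> sE; set m := mass eta.
have [mp mn] := summable_ppart (mass_summable eta).
apply/eqP; rewrite eq_le; apply/andP; split; last first.
  by apply: ge_ereal_sup => _ [p _ <-]; exact: deval_le.
apply: ge_ereal_sup => _ [F [finF FA] <-].
apply/lee_addgt0Pr => e e0.
have mnfin : ppart (\- m)%R setT \is a fin_num by rewrite ge0_fin_numE.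
have [_ [G [finG _] <-]] := ub_ereal_sup_adherent e0 mnfin.
rewrite [X in X - _ < _](_ : _ = ppart (\- m)%R setT)// => Ge.
pose s : seq X := finmap.enum_fset (fset_set (F `|` G)).
have ms x : (F `|` G) x -> x \in s.
  by move=> FGx; rewrite /s in_fset_set ?finite_setU// inE.
have [n nsep] := bits_separate [seq (x, y) | x <- s, y <- s] sE.
rewrite fsbig_ppart; set F' := F `&` _.
have finF' : finite_set F' by exact: finite_setIl.
pose p := (n, map (bits E n) (finmap.enum_fset (fset_set F'))).
have Fp : F' `<=` A `&` coded E p.
  move=> x F'x; split; first by apply: FA; case: F'x.
  by apply: map_f; rewrite in_fset_set// inE.
pose G' := G `&` [set x | (0 < (\- m) x)%R].
have Gp : A `&` coded E p `<=` ~` G'.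
  move=> x [_ /mapP[y]]; rewrite in_fset_set// inE => -[Fy y0] xy [Gx x0].
  have xyE : x = y.
    apply: (nsep (x, y)) xy; apply/allpairsP; exists (x, y).
    by split=> //; apply: ms; [right|left].
  by move: x0 y0; rewrite /= xyE oppr_gt0 => /lt_trans/[apply]; rewrite ltxx.
have small : ppart (\- m)%R (A `&` coded E p) <= e%:E.
  apply: le_trans (ppart_le _ Gp) _.
  move: Ge; rewrite fsbig_ppart -/G'.
  have G'le : \sum_(x \in G') (Num.max ((\- m)%R x) 0)%:E <= ppart (\- m)%R G'.
    by apply: esum_ge; exists G' => //; split => //; exact: finite_setIl.
  have split : ppart (\- m)%R setT = ppart (\- m)%R G' + ppart (\- m)%R (~` G').
    rewrite /ppart (esumID G') ?setTI//.
    by move=> x _; rewrite lee_fin le_max lexx orbT.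
  move=> /lt_le_trans/(_ G'le); rewrite split.
  have G1 : ppart (\- m)%R G' \is a fin_num.
    by rewrite ge0_fin_numE// (le_lt_trans _ mn)//; exact: ppart_le.
  have G2 : ppart (\- m)%R (~` G') \is a fin_num.
    by rewrite ge0_fin_numE// (le_lt_trans _ mn)//; exact: ppart_le.
  rewrite -(fineK G1) -(fineK G2) -!EFinD !lte_fin lee_fin => h; lra.
have pfin : ppart m (A `&` coded E p) \is a fin_num.
  by rewrite ge0_fin_numE// (le_lt_trans _ mp)//; exact: ppart_le.
have nfin : ppart (\- m)%R (A `&` coded E p) \is a fin_num.
  by rewrite ge0_fin_numE// (le_lt_trans _ mn)//; exact: ppart_le.
apply: (@le_trans _ _ (ppart m (A `&` coded E p))).
  by apply: esum_ge; exists F'.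
apply: (@le_trans _ _ (deval eta (A `&` coded E p) + e%:E)).
  rewrite /deval rsumE -/m; move: small.
  rewrite -(fineK pfin) -(fineK nfin) -!EFinD !lee_fin => h; lra.
by rewrite leeD2r//; apply: ereal_sup_ubound; exists p.
Qed.

Lemma measurable_deval A : measurable A ->
  measurable_fun [set: dmeasure R X] (deval ^~ A).
Proof.
move=> mA _ B mB; apply: sub_sigma_algebra; exists A => //.
by exists B.
Qed.

Hypothesis sX : standard_borel R X.

Lemma measurable_ppart_mass A : measurable A ->
  measurable_fun [set: dmeasure R X] (fun eta => ppart (mass eta) A).
Proof.
move=> mA; have [E [mE sE]] := standard_borel_separating sX.
pose h k (eta : dmeasure R X) := if unpickle k is Some p then
  deval eta (A `&` coded E p) else deval eta (A `&` coded E (0%N, [::])).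
rewrite (_ : (fun eta => _) = fun eta => esups (h ^~ eta) 0%N).
  apply: measurable_fun_esups => k; rewrite /h; case: unpickle => [p|];
    apply: measurable_deval; apply: measurableI => //; exact: measurable_coded.
apply/funext => eta; rewrite (ppart_coded _ _ sE); congr ereal_sup.
apply/seteqP; split=> [_ [p _ <-]|_ [k _ <-]].
  by exists (pickle p) => //; rewrite /h pickleK.
by rewrite /h; case: unpickle => [p|]; [exists p|exists (0%N, [::])].
Qed.

Lemma measurable_ppartN_mass A : measurable A ->
  measurable_fun [set: dmeasure R X] (fun eta => ppart (\- mass eta)%R A).
Proof.
move=> mA; rewrite (_ : (fun eta => _) =
    fun eta => ppart (mass eta) A - deval eta A).
  by apply: emeasurable_funB; [exact: measurable_ppart_mass|exact: measurable_deval].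
apply/funext => eta; rewrite /deval rsumE.
have [mp mn] := summable_ppart (mass_summable eta).
have pfin : ppart (mass eta) A \is a fin_num.
  by rewrite ge0_fin_numE// (le_lt_trans _ mp)//; exact: ppart_le.
have nfin : ppart (\- mass eta)%R A \is a fin_num.
  by rewrite ge0_fin_numE// (le_lt_trans _ mn)//; exact: ppart_le.
by rewrite -(fineK pfin) -(fineK nfin) -!EFinD; congr (_%:E); ring.
Qed.

End jordan.

Section signed_integrals.
Context (R : realType) d (X : measurableType d).
Implicit Types (f g : X -> R) (eta : dmeasure R X) (A : set X).

Lemma ppart_indic g A : ppart g A = ppart (\1_A \* g)%R setT.
Proof.
rewrite /ppart esum_mkcond; apply: eq_esum => x _ /=; rewrite indicE.
by case: ifPn => _; rewrite ?mul1r// mul0r maxxx.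
Qed.

Let max0_ge0 (r : R) : (0 <= Num.max r 0)%R.
Proof. by rewrite le_max lexx orbT. Qed.

#[local] Hint Resolve max0_ge0 : core.

Let measurable_pos f : measurable_fun [set: X] f ->
  measurable_fun [set: X] (fun x => Num.max (f x) 0)%R.
Proof. by move=> mf; exact: (@measurable_maxr _ _ _ _ f (cst 0%R)). Qed.

Let measurable_neg f : measurable_fun [set: X] f ->
  measurable_fun [set: X] (fun x => Num.max (- f x) 0)%R.
Proof. by move=> mf; apply: (@measurable_pos (\- f)%R); exact: measurable_funN. Qed.

(** Pointwise, (f g)^+ = f^+ g^+ + f^- g^-. *)
Lemma ppartM f g : measurable_fun [set: X] f ->
  ppart (f \* g)%R setT = \int[ppart g]_x (Num.max (f x) 0)%:E +
                          \int[ppart (\- g)%R]_x (Num.max (- f x) 0)%:E.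
Proof.
move=> mf; rewrite !integral_ppart_fin//;
  [|exact: measurable_neg|exact: measurable_pos].
rewrite /ppart -esumD; try by move=> x _; rewrite lee_fin.
apply: eq_esum => x _; rewrite -EFinD /=; congr (_%:E).
have [f0|/ltW f0] := leP 0%R (f x).
  have nf : (- f x <= 0)%R by rewrite oppr_le0.
  by rewrite (max_r nf) mul0r maxxx addr0.
have nf : (0 <= - f x)%R by rewrite oppr_ge0.
by rewrite (max_l nf) mul0r maxxx add0r mulrNN.
Qed.

Lemma measurable_ppartM f A : standard_borel R X ->
  measurable_fun [set: X] f -> measurable A ->
  measurable_fun [set: dmeasure R X] (fun eta => ppart (f \* mass eta)%R A).
Proof.
move=> sX mf mA.
have m1f : measurable_fun [set: X] (\1_A \* f)%R.
  by apply: measurable_funM => //; exact: measurable_indic.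
under eq_fun do rewrite ppart_indic.
rewrite (_ : (fun eta => _) = fun eta =>
    \int[ppart (mass eta)]_x (Num.max ((\1_A \* f)%R x) 0)%:E +
    \int[ppart (\- mass eta)%R]_x (Num.max (- (\1_A \* f)%R x) 0)%:E); last first.
  apply/funext => eta; rewrite -ppartM//; congr ppart.
  by apply/funext => x /=; rewrite mulrA.
apply: emeasurable_funD.
  apply: (@measurable_fun_integral_kernel _ _ _ _ _ (fun eta => ppart (mass eta))).
  - by move=> U mU; exact: measurable_ppart_mass.
  - by move=> x; rewrite lee_fin.
  - by apply/measurable_EFinP; exact: measurable_pos.
apply: (@measurable_fun_integral_kernel _ _ _ _ _ (fun eta => ppart (\- mass eta)%R)).
- by move=> U mU; exact: measurable_ppartN_mass.
- by move=> x; rewrite lee_fin.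
- by apply/measurable_EFinP; exact: measurable_neg.
Qed.

Lemma measurable_rsumM f A : standard_borel R X ->
  measurable_fun [set: X] f -> measurable A ->
  measurable_fun [set: dmeasure R X] (fun eta => rsum A (f \* mass eta)%R).
Proof.
move=> sX mf mA; under eq_fun do rewrite rsumE.
apply: emeasurable_funB; first exact: measurable_ppartM.
rewrite (_ : (fun eta => _) = fun eta => ppart ((\- f) \* mass eta)%R A).
  by apply: measurable_ppartM => //; exact: measurable_funN.
by apply/funext => eta; congr ppart; apply/funext => x /=; rewrite mulNr.
Qed.

Lemma measurable_dint f : standard_borel R X -> measurable_fun [set: X] f ->
  measurable_fun [set: dmeasure R X] (fun eta => dint eta f).
Proof. by move=> sX mf; exact: measurable_rsumM. Qed.

Lemma measurable_multdom f : standard_borel R X -> measurable_fun [set: X] f ->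
  measurable (multdom f : set (dmeasure R X)).
Proof.
move=> sX mf; rewrite (_ : multdom f =
    [set eta | \esum_(x in [set: X]) `|(f x * mass eta x)%:E| < +oo])//.
under eq_set do rewrite (summableE_ppart (fun x => f x * mass _ x)%R).
rewrite -[X in measurable X]setTI; apply: emeasurable_fun_infty_o => //.
apply: emeasurable_funD; first exact: measurable_ppartM.
rewrite (_ : (fun eta => _) = fun eta => ppart ((\- f) \* mass eta)%R setT).
  by apply: measurable_ppartM => //; exact: measurable_funN.
by apply/funext => eta; congr ppart; apply/funext => x /=; rewrite mulNr.
Qed.

Lemma mass_mult f eta : multdom f eta -> mass (mult f eta) = (f \* mass eta)%R.
Proof. by rewrite /mult; case: pselect. Qed.

Lemma measurable_mult f : standard_borel R X -> measurable_fun [set: X] f ->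
  measurable_fun [set: dmeasure R X] (mult f).
Proof.
move=> sX mf; apply: (@measurability _ _ _ (dmeasure R X) setT (mult f)
  (\bigcup_(A in (measurable : set (set X)))
     preimage_set_system [set: dmeasure R X] (deval ^~ A) measurable)) => //.
move=> _ [_ [A mA [B mB <-]] <-]; rewrite !setTI.
rewrite [X in measurable X](_ : _ = (fun eta => if `[< multdom f eta >] then
    rsum A (f \* mass eta)%R else 0) @^-1` B).
  have mdom : measurable_fun [set: dmeasure R X]
      (fun eta => `[< multdom f eta >]).
    apply: (measurable_fun_bool true); rewrite setTI.
    rewrite (_ : _ @^-1` _ = multdom f); first exact: measurable_multdom.
    by apply/seteqP; split => eta /=; [move/asboolP|move=> ?; apply/asboolP].
  have m0 : measurable_fun [set: dmeasure R X] (fun=> 0 : \bar R).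
    exact: measurable_cst.
  have mif := measurable_fun_ifT mdom (measurable_rsumM sX mf mA) m0.
  by rewrite -[X in measurable X]setTI; exact: (mif measurableT _ mB).
have e eta : deval (mult f eta) A = if `[< multdom f eta >] then
    rsum A (f \* mass eta)%R else 0.
  rewrite /deval; case: asboolP => me; first by rewrite mass_mult.
  rewrite /mult; case: pselect => // _ /=.
  by rewrite rsumE /ppart !esum1 ?subee// => x _ /=; rewrite ?oppr0 maxxx.
by apply/seteqP; split=> eta /=; rewrite e.
Qed.

(** On positive measures the signed integral is a Lebesgue integral, with the
    same convention for infinite positive and negative parts. *)
Lemma dintE f eta : dpositive eta -> measurable_fun [set: X] f ->
  dint eta f = \int[ppart (mass eta)]_x (f x)%:E.
Proof.
move=> pe mf; rewrite /dint rsumE ppartM//.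
have null (h : X -> R) : measurable_fun [set: X] h -> (forall x, 0 <= h x)%R ->
    \int[ppart (\- mass eta)%R]_x (h x)%:E = 0.
  move=> mh h0; rewrite integral_ppart_fin// /ppart esum1// => x _ /=.
  congr (_%:E); apply/max_idPr; rewrite mulrN oppr_le0 mulr_ge0//; exact: pe.
have mfN : measurable_fun [set: X] (\- f)%R by exact: measurable_funN.
rewrite null//; last exact: measurable_neg.
rewrite adde0 (_ : (\- _)%R = ((\- f) \* mass eta)%R); last first.
  by apply/funext => x /=; rewrite mulNr.
rewrite ppartM// null//; last exact: measurable_neg.
rewrite adde0 [RHS]integralE; congr (_ - _); apply: eq_integral => x _.
  by rewrite funeposE /= EFin_max.
by rewrite funenegE /= EFin_max.
Qed.

Lemma ppart_mass_lty eta : ppart (mass eta) setT < +oo.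
Proof. by have [] := summable_ppart (mass_summable eta). Qed.

Lemma multdom_dint f eta : dpositive eta -> (forall x, 0 <= f x)%R ->
  dint eta f < +oo -> multdom f eta.
Proof.
move=> pe f0; rewrite /dint rsumE /multdom /= /summable.
rewrite (summableE_ppart (fun x => f x * mass eta x)%R).
have -> : ppart (\- (fun x => f x * mass eta x))%R setT = 0.
  rewrite /ppart esum1// => x _ /=.
  by congr (_%:E); apply/max_idPr; rewrite oppr_le0 mulr_ge0//; exact: pe.
by rewrite sube0 adde0.
Qed.

Lemma dpositive_mult f eta : (forall x, 0 <= f x)%R ->
  dpositive eta -> dpositive (mult f eta).
Proof.
move=> f0 pe x; rewrite /mult; case: pselect => // s /=.
by rewrite mulr_ge0//; exact: pe.
Qed.

Lemma dint_mult f g eta : multdom f eta -> dint (mult f eta) g = dint eta (g \* f)%R.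
Proof.
move=> fe; rewrite /dint mass_mult//; congr rsum.
by apply/funext => x /=; rewrite mulrA.
Qed.

End signed_integrals.

Lemma dint0 (R : realType) (X : choiceType) (eta : dmeasure R X) :
  dint eta (fun=> 0%R) = 0.
Proof.
by rewrite /dint /rsum !esum1 ?sube0// => x _;
  rewrite ?funeposE ?funenegE /= mul0r ?oppr0 maxxx.
Qed.

(** * Preliminaries from real analysis *)

Lemma measurable_expeR (R : realType) : measurable_fun [set: \bar R] (@expeR R).
Proof.
apply: (measurability _ (ErealGenOInfty.measurableE R)) => //.
move=> _ [_ [y ->] <-]; rewrite setTI.
have [y0|y0] := ltP y 0%R.
  rewrite (_ : _ @^-1` _ = setT)//; apply/seteqP; split => // x _ /=.
  by rewrite in_itv/= andbT; apply: lt_le_trans (expeR_ge0 x); rewrite lte_fin.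
have y0' : 0 <= y%:E by rewrite lee_fin.
have [z zy] := expeR_total y0'.
rewrite (_ : _ @^-1` _ = `]z, +oo[%classic); first exact: emeasurable_itv.
by apply/seteqP; split => x /=; rewrite !in_itv/= !andbT -zy ?lte_expeR.
Qed.

Lemma measurable_invr (R : realType) : measurable_fun [set: R] (@GRing.inv R).
Proof.
rewrite (_ : GRing.inv = fun x : R => if (0 < x)%R then expR (- ln x)%R else
    if (x < 0)%R then (- expR (- ln (- x)))%R else 0%R).
  apply: measurable_fun_ifT; first exact: measurable_fun_ltr.
    apply: (measurableT_comp (@measurable_expR R)); apply: measurable_funN.
    exact: measurable_ln.
  apply: measurable_fun_ifT => //; first exact: measurable_fun_ltr.
  apply: measurable_funN; apply: (measurableT_comp (@measurable_expR R)).
  apply: measurable_funN; apply: (measurableT_comp (@measurable_ln R)).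
  exact: measurable_funN.
apply/funext => x; case: ltgtP => [x0|x0|<-]; last by rewrite invr0.
  by rewrite expRN lnK ?posrE.
by rewrite expRN lnK ?posrE ?oppr_gt0// invrN opprK.
Qed.

(** The order isomorphism [expeR] from the extended line onto the closed
    positive half-line turns suprema into infima after a change of sign, so no
    distinction between finite and infinite limits is needed. *)
Lemma cvg_expeRN (R : realType) (u : nat -> \bar R) (l : \bar R) :
  {homo u : m n / (m <= n)%N >-> m <= n} -> u @ \oo --> l ->
  (fun n => expeR (- u n)) @ \oo --> expeR (- l).
Proof.
move=> nd_u ul.
have -> : l = ereal_sup (range u).
  by apply: cvg_unique ul (ereal_nondecreasing_cvgn nd_u) => //.
have : {homo (fun n => expeR (- u n)) : m n / (m <= n)%N >-> n <= m}.
  by move=> m n mn; rewrite lee_expeR leeN2 nd_u.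
move=> /ereal_nonincreasing_cvgn; set i := ereal_inf _.
suff -> : i = expeR (- ereal_sup (range u)) by [].
have i0 : 0 <= i by apply: le_ereal_inf_tmp => _ [n _ <-]; exact: expeR_ge0.
apply/eqP; rewrite eq_le; apply/andP; split; last first.
  apply: le_ereal_inf_tmp => _ [n _ <-]; rewrite lee_expeR leeN2.
  by apply: ereal_sup_ubound; exists n.
have [y yi] := expeR_total i0; rewrite -yi lee_expeR leeNr.
apply: ge_ereal_sup => _ [n _ <-]; rewrite leeNr -lee_expeR yi.
by apply: ereal_inf_lbound; exists n.
Qed.

Section density_measure.
Context d (T : measurableType d) (R : realType) (mu : {measure set T -> \bar R}).
Variable f : T -> \bar R.
Hypotheses (mf : measurable_fun [set: T] f) (f0 : forall t, 0 <= f t).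

Import HBNNSimple.

(** The measure is only asserted to exist, so that the formula for its integrals
    can be used without the proofs from which it is built. *)
Lemma density_measure : exists Q : {measure set T -> \bar R},
  (forall B, measurable B -> Q B = \int[mu]_(t in B) f t) /\
  (forall g, measurable_fun [set: T] g -> (forall t, 0 <= g t) ->
    \int[Q]_t g t = \int[mu]_t (g t * f t)).
Proof.
pose q B := \int[mu]_(t in B) f t.
have q0 : q set0 = 0 by exact: integral_set0.
have qge0 B : 0 <= q B by apply: integral_ge0 => t _.
have qsigma := @semi_sigma_additive_nng_induced _ _ _ mu _ mf f0.
pose qm := isMeasure.Build _ _ _ q q0 qge0 qsigma.
pose Q : {measure set T -> \bar R} := HB.pack q qm.
exists Q; split=> // g mg g0; pose g_ := nnsfun_approx measurableT mg.
have simple (h : {nnsfun T >-> R}) :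
    \int[Q]_t (h t)%:E = \int[mu]_t ((h t)%:E * f t).
  under eq_integral do rewrite fimfunE -fsumEFin//.
  rewrite ge0_integral_fsum//; last 2 first.
    - by move=> r; exact/measurable_EFinP/measurableT_comp.
    - by move=> r t _; rewrite EFinM nnfun_muleindic_ge0.
  under [RHS]eq_integral => t _.
    rewrite fimfunE -fsumEFin// muleC ge0_mule_fsumr; last first.
      by move=> r; rewrite EFinM nnfun_muleindic_ge0.
    over.
  rewrite ge0_integral_fsum//; last 2 first.
    - move=> r; apply: emeasurable_funM => //.
      exact/measurable_EFinP/measurableT_comp.
    - by move=> r t _; rewrite mule_ge0// EFinM nnfun_muleindic_ge0.
  apply: eq_fsbigr => r _; rewrite integralZl_indic_nnsfun// integral_indic// setIT.
  have [r0|r0] := ltP r 0%R.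
    rewrite preimage_nnfun0// measure0 mule0 integral0_eq// => t _.
    by rewrite indic0 mulr0 mule0.
  rewrite /= /q (integral_mkcond (h @^-1` [set r])) -ge0_integralZl//; first last.
  - by move=> t _; apply: erestrict_ge0.
  - by apply/(measurable_restrictT _ _).1 => //; exact: measurable_funTS.
  apply: eq_integral => t _; rewrite patchE indicE.
  by case: ifPn => _; rewrite ?mulr1 ?mulr0 ?mule0// muleC.
have cvg_simple : (fun n => \int[Q]_t (g_ n t)%:E) @ \oo --> \int[Q]_t g t.
  have -> : \int[Q]_t g t = \int[Q]_t limn (EFin \o g_ ^~ t).
    by apply: eq_integral => t _; apply/esym/cvg_lim => //; exact: cvg_nnsfun_approx.
  apply: cvg_monotone_convergence => //.
  - by move=> n; exact/measurable_EFinP.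
  - by move=> n t _; rewrite lee_fin.
  - by move=> t _ m n mn; rewrite lee_fin; exact/lefP/nd_nnsfun_approx.
have : (fun n => \int[mu]_t ((g_ n t)%:E * f t)) @ \oo --> \int[mu]_t (g t * f t).
  have nd t m n : (m <= n)%N -> (g_ m t)%:E * f t <= (g_ n t)%:E * f t.
    by move=> mn; rewrite lee_wpmul2r// lee_fin; exact/lefP/nd_nnsfun_approx.
  have -> : \int[mu]_t (g t * f t) = \int[mu]_t limn (fun n => (g_ n t)%:E * f t).
    apply: eq_integral => t _; apply/esym/cvg_lim => //.
    have gt : (fun n => (g_ n t)%:E) @ \oo --> g t by exact: cvg_nnsfun_approx.
    have [ffin|finf] := boolP (f t \is a fin_num); first exact: cvgeZr.
    have foo : f t = +oo by apply/eqP; move: finf; rewrite ge0_fin_numE// -leNgt leye_eq.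
    have [g00|gn0] := eqVneq (g t) 0; last first.
      rewrite foo; apply: cvgeM => //; last exact: cvg_cst.
      by rewrite mule_defE// orbC (negbTE gn0) .
    rewrite g00 mul0e (_ : (fun n => _) = cst 0); first exact: cvg_cst.
    apply/funext => n /=; suff -> : g_ n t = 0%R by rewrite mul0e.
    apply/eqP; rewrite eq_le fun_ge0 andbT -lee_fin.
    have -> : 0%:E = g t by rewrite g00.
    by rewrite /g_ nnsfun_approxE; apply: le_approx.
  apply: cvg_monotone_convergence => //.
  - by move=> n; apply: emeasurable_funM => //; exact/measurable_EFinP.
  - by move=> n t _; rewrite mule_ge0// lee_fin.
  - by move=> t _ m n mn; exact: nd.
under eq_fun do rewrite -simple.
by move=> /(cvg_unique _ cvg_simple); apply.
Qed.

End density_measure.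

Section step_limit.
Variable R : realType.
Implicit Types (u v c q : R).

Lemma bernoulli_ge v n : (-1 <= v)%R -> (1 + n%:R * v <= (1 + v) ^+ n)%R.
Proof.
move=> v1; elim: n => [|n ih]; first by rewrite expr0 mul0r addr0.
rewrite exprS; apply: (@le_trans _ _ ((1 + v) * (1 + n%:R * v))%R).
  have : (0 <= n%:R * v ^+ 2)%R by rewrite mulr_ge0// sqr_ge0.
  rewrite -natr1; set w := n%:R; nra.
by apply: ler_wpM2l => //; lra.
Qed.

(** With q <= r ^ 2 and r < 1, the inequality n r ^ n <= 1 / (1/r - 1) is
    Bernoulli's, and a second factor r ^ n remains. *)
Lemma cvg_natrM_expr q : (0 <= q < 1)%R ->
  (fun n => n%:R * q ^+ n)%R @ \oo --> (0 : R)%R.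
Proof.
move=> /andP[q0 q1]; pose r := ((1 + q) / 2)%R.
have r0 : (0 < r)%R by rewrite /r; lra.
have r1 : (r < 1)%R by rewrite /r; lra.
have qr : (q <= r ^+ 2)%R by rewrite /r; nra.
pose h := (r^-1 - 1)%R.
have h0 : (0 < h)%R by rewrite subr_gt0 invf_gt1.
apply: (@squeeze_cvgr _ _ _ _ (cst 0%R) (fun n => h^-1 * r ^+ n)%R).
- near=> n; rewrite mulr_ge0 ?exprn_ge0//=.
  rewrite (@le_trans _ _ (n%:R * (r ^+ n * r ^+ n))%R)//.
    by rewrite ler_wpM2l// -exprMn -expr2 lerXn2r ?nnegrE// sqr_ge0.
  rewrite mulrA ler_wpM2r ?exprn_ge0 ?(ltW r0)//.
  have nr : (n%:R * h <= r^-1 ^+ n)%R.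
    have -> : (r^-1 = 1 + h)%R by rewrite /h addrC subrK.
    apply: le_trans (bernoulli_ge _ _); first by rewrite lerDr.
    by rewrite (le_trans _ (ltW h0)).
  rewrite -[leRHS]mul1r ler_pdivlMr// mulrAC -ler_pdivlMr ?exprn_gt0//.
  by rewrite mul1r -exprVn.
- exact: cvg_cst.
- rewrite -[X in _ --> X](mulr0 h^-1%R); apply: cvgMl_tmp.
  by apply: cvg_expr; rewrite ger0_norm// ltW.
Unshelve. all: by end_near. Qed.

(** Polynomials in u that converge to the indicator of u < c. The exponent N is
    the integer part of n / c ^ n: if u < c then N u ^ n <= n (u/c) ^ n tends to
    0, and if c <= u then N u ^ n >= n - 1 tends to infinity; the factor n makes
    the limit 0 at u = c too. *)
Lemma cvg_step u c : (0 <= u <= 1)%R -> (0 < c)%R ->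
  (fun n => (1 - u ^+ n) ^+ Num.truncn (n%:R * c^-1 ^+ n))%R @ \oo -->
  (if (u < c)%R then 1%R else 0%R : R).
Proof.
move=> /andP[u0 u1] c0; set N := fun n => Num.truncn (n%:R * c^-1 ^+ n)%R.
have un n : (0 <= u ^+ n <= 1)%R by rewrite exprn_ge0//= exprn_ile1.
have Nle n : ((N n)%:R <= n%:R * c^-1 ^+ n)%R.
  by rewrite truncn_le// mulr_ge0// exprn_ge0// invr_ge0 ltW.
have Nge n : (n%:R * c^-1 ^+ n - 1 <= (N n)%:R)%R.
  by rewrite lerBlDr natr1 ltW// truncnS_gt.
case: ifPn => [uc|]; last rewrite -leNgt => cu.
  apply: (@squeeze_cvgr _ _ _ _ (fun n => 1 - n%:R * (u / c) ^+ n)%R (cst 1%R)).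
  - near=> n; have /andP[a b] := un n; apply/andP; split; last first.
      by rewrite exprn_ile1 //=; lra.
    apply: le_trans (bernoulli_ge _ _); last by lra.
    rewrite lerD2l mulrN lerN2 exprMn mulrCA [leRHS]mulrC ler_wpM2r//; exact: Nle.
  - have : (fun n => 1 - n%:R * (u / c) ^+ n)%R @ \oo --> (1 - 0 : R)%R.
      apply: cvgB; first exact: cvg_cst.
      by apply: cvg_natrM_expr; rewrite divr_ge0 ?(ltW c0)//= ltr_pdivrMr// mul1r.
    by rewrite subr0.
  - exact: cvg_cst.
apply: (@squeeze_cvgr _ _ _ _ (cst 0%R) (@harmonic R \o predn)).
- near=> n; have /andP[a b] := un n; apply/andP; split.
    by rewrite exprn_ge0//; lra.
  rewrite /harmonic /= prednK; last by near: n; exact: nbhs_infty_gt.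
  have n0 : (0 < n)%N by near: n; exact: nbhs_infty_gt.
  have h1 : (n%:R <= 1 + (N n)%:R * u ^+ n)%R.
    have : (n%:R <= (n%:R * c^-1 ^+ n) * u ^+ n)%R.
      rewrite -mulrA -exprMn ler_peMr// exprn_ege1//.
      by rewrite ler_pdivlMl// mulr1.
    have := Nge n; set x := (N n)%:R; set y := (n%:R * _)%R => xy nx.
    have : ((y - 1) * u ^+ n <= x * u ^+ n)%R by rewrite ler_wpM2r.
    lra.
  have h2 := le_trans h1 (bernoulli_ge (N n) (_ : -1 <= u ^+ n)%R).
  rewrite -[leRHS]mul1r ler_pdivlMr ?ltr0n//.
  apply: (@le_trans _ _ ((1 - u ^+ n) ^+ N n * (1 + u ^+ n) ^+ N n)%R).
    by rewrite ler_wpM2l ?h2 ?exprn_ge0//; lra.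
  by rewrite -exprMn exprn_ile1//; nra.
- exact: cvg_cst.
- by rewrite -cvg_shiftS /=; exact: cvg_harmonic.
Unshelve. all: by end_near. Qed.

End step_limit.

(** * Laplace transforms determine laws of positive discrete measures *)

Section laplace_transform.
Context (R : realType) d (X : measurableType d).
Implicit Types (f g : X -> R) (eta : dmeasure R X) (A : set X).

(** The functions at which [gamma_measure] prescribes the Laplace transform. *)
Definition admissible f := [/\ measurable_fun [set: X] f,
  forall x, (0 <= f x)%R & exists M : R, forall x, (f x <= M)%R].

Lemma admissible_indic A (n : nat) : measurable A ->
  admissible (fun x => n%:R * \1_A x)%R.
Proof.
move=> mA; split.
- apply: measurable_funM => //; exact: measurable_indic.
- by move=> x; rewrite mulr_ge0.
- exists n%:R => x; rewrite indicE; case: (_ \in _); rewrite ?mulr1 ?mulr0//.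
Qed.

Lemma admissibleD f g : admissible f -> admissible g -> admissible (f \+ g)%R.
Proof.
move=> [mf f0 [M fM]] [mg g0 [N gN]]; split.
- exact: measurable_funD.
- by move=> x; rewrite addr_ge0.
- by exists (M + N)%R => x; rewrite lerD.
Qed.

Lemma dint_ge0 f eta : dpositive eta -> measurable_fun [set: X] f ->
  (forall x, 0 <= f x)%R -> 0 <= dint eta f.
Proof.
by move=> pe mf f0; rewrite dintE//; apply: integral_ge0 => x _; rewrite lee_fin.
Qed.

Lemma dintD f g eta : dpositive eta ->
  measurable_fun [set: X] f -> (forall x, 0 <= f x)%R ->
  measurable_fun [set: X] g -> (forall x, 0 <= g x)%R ->
  dint eta (f \+ g)%R = dint eta f + dint eta g.
Proof.
move=> pe mf f0 mg g0; rewrite !dintE//; last exact: measurable_funD.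
rewrite -ge0_integralD//; try by move=> x _; rewrite lee_fin.
  exact/measurable_EFinP.
exact/measurable_EFinP.
Qed.

Lemma dintZ (c : R) f eta : dpositive eta -> (0 <= c)%R ->
  measurable_fun [set: X] f -> (forall x, 0 <= f x)%R ->
  dint eta (fun x => c * f x)%R = c%:E * dint eta f.
Proof.
move=> pe c0 mf f0; rewrite !dintE//; last exact: measurable_funM.
under eq_integral do rewrite EFinM.
rewrite ge0_integralZl_EFin//; last exact/measurable_EFinP.
by move=> x _; rewrite lee_fin.
Qed.

Lemma dint_le f g eta : dpositive eta ->
  measurable_fun [set: X] f -> (forall x, 0 <= f x)%R ->
  measurable_fun [set: X] g -> (forall x, f x <= g x)%R ->
  dint eta f <= dint eta g.
Proof.
move=> pe mf f0 mg fg; rewrite !dintE//; apply: ge0_le_integral => //.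
- by move=> x _; rewrite lee_fin.
- exact/measurable_EFinP.
- exact/measurable_EFinP.
- by move=> x _; rewrite lee_fin.
Qed.

Lemma dint_lty f eta (M : R) : dpositive eta -> measurable_fun [set: X] f ->
  (forall x, 0 <= f x)%R -> (forall x, f x <= M)%R -> dint eta f < +oo.
Proof.
move=> pe mf f0 fM; have cM : measurable_fun [set: X] (cst M) by [].
apply: (le_lt_trans (dint_le pe mf f0 cM fM)).
rewrite dintE// (integral_cst _ _ M%:E)//.
apply: lte_mul_pinfty => //; last exact: ppart_mass_lty.
by rewrite lee_fin (le_trans (f0 point)).
Qed.

Lemma dint_fin f eta : dpositive eta -> admissible f -> dint eta f \is a fin_num.
Proof.
move=> pe [mf f0 [M fM]]; rewrite ge0_fin_numE ?dint_ge0//.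
exact: (dint_lty pe mf f0 fM).
Qed.

Lemma dint_indic eta A : dint eta \1_A = deval eta A.
Proof.
rewrite /dint /deval !rsumE; congr (_ - _); rewrite [RHS]ppart_indic//.
by congr ppart; apply/funext => x /=; rewrite mulrN.
Qed.

(** The truncation by 1 is inactive on positive measures; it keeps the
    transform in the unit interval on the signed ones, which form a null set in
    all applications. *)
Definition lap f eta : R := Num.min 1%R (expR (- fine (dint eta f))).

Lemma lap01 f eta : (0 <= lap f eta <= 1)%R.
Proof. by rewrite /lap le_min ler01 expR_ge0/= ge_min lexx. Qed.

Lemma lap_fine f eta : dpositive eta -> admissible f ->
  lap f eta = expR (- fine (dint eta f)).
Proof.
move=> pe [mf f0 _]; apply/min_idPr; rewrite -expR0 ler_expR oppr_le0.
by apply: fine_ge0; exact: dint_ge0.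
Qed.

Lemma lapE f eta : dpositive eta -> admissible f ->
  (lap f eta)%:E = expeR (- dint eta f).
Proof. by move=> pe af; rewrite lap_fine// -[in RHS](fineK (dint_fin pe af)). Qed.

Lemma lapD f g eta : dpositive eta -> admissible f -> admissible g ->
  lap (f \+ g)%R eta = (lap f eta * lap g eta)%R.
Proof.
move=> pe af ag; have [mf f0 _] := af; have [mg g0 _] := ag.
rewrite !lap_fine//; last exact: admissibleD.
by rewrite dintD// fineD ?dint_fin// opprD expRD.
Qed.

Lemma lapMn eta A (n : nat) : dpositive eta -> measurable A ->
  lap (fun x => n%:R * \1_A x)%R eta = (expR (- fine (deval eta A)) ^+ n)%R.
Proof.
move=> pe mA; rewrite lap_fine//; last exact: admissible_indic.
have a1 : admissible (fun x => 1%:R * \1_A x : R)%R by exact: admissible_indic.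
rewrite -expRM_natl -dint_indic dintE//; last by have [] := admissible_indic n mA.
under eq_integral do rewrite EFinM.
rewrite ge0_integralZl_EFin//; last first.
  by apply/measurable_EFinP; exact: measurable_indic.
rewrite -(dintE pe (measurable_indic mA)).
have -> : \1_A = (fun x => 1%:R * \1_A x : R)%R by apply/funext => x; rewrite mul1r.
by rewrite fineM ?dint_fin//= mulrN.
Qed.

Lemma measurable_lap f : standard_borel R X -> measurable_fun [set: X] f ->
  measurable_fun [set: dmeasure R X] (lap f).
Proof.
move=> sX mf; apply: (@measurable_minr _ _ _ _ (cst 1%R)) => //.
apply: (measurableT_comp (@measurable_expR R)).
apply: measurable_funN; apply: measurableT_comp; first exact: fine_measurable.
exact: measurable_dint.
Qed.

Lemma measurable_expeRN_dint f : standard_borel R X -> measurable_fun [set: X] f ->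
  measurable_fun [set: dmeasure R X] (fun eta => expeR (- dint eta f)).
Proof.
move=> sX mf; apply: measurableT_comp; first exact: measurable_expeR.
by apply: measurableT_comp => //; exact: measurable_dint.
Qed.

End laplace_transform.

Section laplace_unique.
Context (R : realType) d (X : measurableType d).
Local Notation D := (dmeasure R X).
Implicit Types (f : X -> R) (A : set X) (h : D -> R).

Hypothesis sX : standard_borel R X.

Definition lapint (Q : {measure set D -> \bar R}) f h : \bar R :=
  \int[Q]_eta (lap f eta * h eta)%:E.

Let measurable_laph f h : measurable_fun [set: X] f ->
  measurable_fun [set: D] h ->
  measurable_fun [set: D] (fun eta => (lap f eta * h eta)%:E).
Proof.
move=> mf mh; apply/measurable_EFinP; apply: measurable_funM => //.
exact: measurable_lap.
Qed.

Section one_measure.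
Variable Q : {measure set D -> \bar R}.
Hypothesis Qpos : {ae Q, forall eta : D, dpositive eta}.
Hypothesis Qfin : Q [set: D] < +oo.

(** The product of the transforms at f and at n times the indicator of A is the
    transform at their sum: multiplying by a polynomial in the mass of A only
    changes the test function. *)
Lemma lapint_split f h A n : admissible f ->
  measurable_fun [set: D] h -> (forall eta, 0 <= h eta <= 1)%R ->
  measurable A ->
  lapint Q f h =
  lapint Q f (fun eta => h eta * (1 - lap (fun x => n%:R * \1_A x) eta))%R +
  lapint Q (f \+ (fun x => n%:R * \1_A x))%R h.
Proof.
move=> af mh h01 mA; have [mf f0 _] := af.
have aA := admissible_indic R n mA; have [mA1 _ _] := aA.
have mg : measurable_fun [set: D]
    (fun eta => h eta * (1 - lap (fun x => n%:R * \1_A x) eta))%R.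
  apply: measurable_funM => //; apply: measurable_funB => //.
  exact: measurable_lap.
have l0 f' eta : (0 <= lap f' eta :> R)%R by case/andP: (lap01 f' eta).
have l1 f' eta : (lap f' eta <= 1 :> R)%R by case/andP: (lap01 f' eta).
have h0 eta : (0 <= h eta)%R by case/andP: (h01 eta).
rewrite /lapint -ge0_integralD//; last 4 first.
- move=> eta _; rewrite lee_fin mulr_ge0// mulr_ge0// subr_ge0//.
- exact: measurable_laph.
- by move=> eta _; rewrite lee_fin mulr_ge0.
- by apply: measurable_laph => //; exact: measurable_funD.
apply: ge0_ae_eq_integral => //.
- exact: measurable_laph.
- apply: emeasurable_funD; first exact: measurable_laph.
  by apply: measurable_laph => //; exact: measurable_funD.
- by move=> eta _; rewrite lee_fin mulr_ge0.
- move=> eta _; rewrite adde_ge0// lee_fin mulr_ge0// mulr_ge0// subr_ge0//.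
apply: filterS Qpos => eta pe _; rewrite lapD// -EFinD; congr (_%:E); ring.
Qed.

Lemma lapint_lty f h : admissible f -> measurable_fun [set: D] h ->
  (forall eta, 0 <= h eta <= 1)%R -> lapint Q f h < +oo.
Proof.
move=> af mh h01; have [mf f0 _] := af.
apply: le_lt_trans Qfin; rewrite -[leRHS]mul1e -integral_cst//.
apply: ge0_le_integral => //.
- move=> eta _; rewrite lee_fin mulr_ge0//.
    by case/andP: (lap01 f eta).
  by case/andP: (h01 eta).
- exact: measurable_laph.
- move=> eta _; rewrite lee_fin /=.
  case/andP: (lap01 f eta) => a b; case/andP: (h01 eta) => c e.
  by rewrite mulr_ile1.
Qed.

Lemma lapint_cvg f (h_ : nat -> D -> R) h : admissible f ->
  (forall n, measurable_fun [set: D] (h_ n)) -> measurable_fun [set: D] h ->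
  (forall n eta, 0 <= h_ n eta <= 1)%R ->
  (forall eta, dpositive eta -> h_ ^~ eta @ \oo --> h eta) ->
  (fun n => lapint Q f (h_ n)) @ \oo --> lapint Q f h.
Proof.
move=> af mh_ mh h01 hh; have [mf f0 _] := af.
have [] := @dominated_convergence _ _ _ Q setT measurableT
  (fun n eta => (lap f eta * h_ n eta)%:E) (fun eta => (lap f eta * h eta)%:E)
  (cst 1) => //.
- by move=> n; exact: measurable_laph.
- exact: measurable_laph.
- apply: filterS Qpos => eta pe _; apply: cvg_EFin; first by near=> n.
  by apply: cvgMl_tmp; exact: hh.
- apply/integrableP; split => //; under eq_integral do rewrite gee0_abs//.
  by rewrite (integral_cst _ _ 1)// mul1e.
- apply: filterE => eta n _; rewrite lee_fin.
  case/andP: (lap01 f eta) => a b; case/andP: (h01 n eta) => c e.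
  by rewrite ger0_norm ?mulr_ge0// mulr_ile1.
Unshelve. all: by end_near. Qed.

End one_measure.

Variables Q1 Q2 : {measure set D -> \bar R}.
Hypothesis Q1pos : {ae Q1, forall eta : D, dpositive eta}.
Hypothesis Q2pos : {ae Q2, forall eta : D, dpositive eta}.
Hypothesis Q1fin : Q1 [set: D] < +oo.
Hypothesis Q2fin : Q2 [set: D] < +oo.

Let agree h := forall f, admissible f -> lapint Q1 f h = lapint Q2 f h.

(** Quantifying over the test function f in [agree] is what makes this
    induction on N work: by [lapint_split] the integral for N.+1 at f is the
    difference of the integrals for N at f and at a larger test function. *)
Let agree_step h A n (N : nat) : measurable_fun [set: D] h ->
  (forall eta, 0 <= h eta <= 1)%R -> measurable A -> agree h ->
  agree (fun eta => h eta * (1 - lap (fun x => n%:R * \1_A x) eta) ^+ N)%R.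
Proof.
move=> mh h01 mA ah; have [mA1 _ _] := admissible_indic R n mA.
set U := lap _; have U01 eta : (0 <= 1 - U eta <= 1)%R.
  by case/andP: (lap01 (fun x => n%:R * \1_A x)%R eta) => a b; rewrite /U; lra.
have mU : measurable_fun [set: D] U by exact: measurable_lap.
have mhN N' : measurable_fun [set: D] (fun eta => h eta * (1 - U eta) ^+ N')%R.
  apply: measurable_funM => //; apply: measurable_funX.
  exact: measurable_funB.
have hN01 N' eta : (0 <= h eta * (1 - U eta) ^+ N' <= 1)%R.
  case/andP: (h01 eta) => a b; case/andP: (U01 eta) => c e.
  by rewrite mulr_ge0 ?exprn_ge0//= mulr_ile1 ?exprn_ge0// exprn_ile1.
elim: N => [|N ih] f af.
  have E0 Q : lapint Q f (fun eta => h eta * (1 - U eta) ^+ 0)%R = lapint Q f h.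
    by apply: eq_integral => eta _; rewrite expr0 mulr1.
  by rewrite !E0; exact: ah.
have afA : admissible (f \+ (fun x => n%:R * \1_A x))%R.
  by apply: admissibleD => //; exact: admissible_indic.
have E Q : lapint Q f (fun eta => h eta * (1 - U eta) ^+ N.+1)%R =
    lapint Q f (fun eta => h eta * (1 - U eta) ^+ N * (1 - U eta))%R.
  by apply: eq_integral => eta _; rewrite exprSr (mulrA (h eta)).
have := ih f af; rewrite (lapint_split Q1pos n af (mhN N) (hN01 N) mA).
rewrite (lapint_split Q2pos n af (mhN N) (hN01 N) mA) -!E ih//.
have := lapint_lty Q2fin afA (mhN N) (hN01 N).
set z := lapint Q2 _ _ => zoo.
have zfin : z \is a fin_num.
  rewrite ge0_fin_numE//; apply: integral_ge0 => eta _.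
  rewrite lee_fin mulr_ge0//.
    by case/andP: (lap01 (f \+ (fun x => n%:R * \1_A x))%R eta).
  by case/andP: (hN01 N eta).
by move/(congr1 (fun y => y - z)); rewrite !addeK.
Qed.

(** The event that A has mass greater than y means that exp (- mass) is less
    than exp (- y), so its indicator is a limit of polynomials as in [cvg_step]. *)
Let agree_cut h A (y : R) : measurable_fun [set: D] h ->
  (forall eta, 0 <= h eta <= 1)%R -> measurable A -> agree h ->
  agree (fun eta => h eta * \1_[set eta : D | (y%:E < deval eta A)%E] eta)%R.
Proof.
move=> mh h01 mA ah f af.
pose c := expR (- y).
pose h_ n eta := (h eta * (1 - lap (fun x => n%:R * \1_A x) eta) ^+
  Num.truncn (n%:R * c^-1 ^+ n))%R.
have U01 n (eta : D) : (0 <= 1 - lap (fun x => n%:R * \1_A x) eta <= 1)%R.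
  by case/andP: (lap01 (fun x => n%:R * \1_A x)%R eta) => a b; lra.
have mh_ n : measurable_fun [set: D] (h_ n).
  apply: measurable_funM => //; apply: measurable_funX.
  apply: measurable_funB => //; apply: measurable_lap => //.
  by have [] := admissible_indic R n mA.
have h_01 n eta : (0 <= h_ n eta <= 1)%R.
  case/andP: (h01 eta) => a b; case/andP: (U01 n eta) => p q.
  by rewrite mulr_ge0 ?exprn_ge0//= mulr_ile1 ?exprn_ge0// exprn_ile1.
set hl := (X in lapint _ _ X).
have mhl : measurable_fun [set: D] hl.
  apply: measurable_funM => //; apply: measurable_indic.
  rewrite -[X in measurable X]setTI; apply: emeasurable_fun_o_infty => //.
  exact: measurable_deval.
have lim eta : dpositive eta -> h_ ^~ eta @ \oo --> hl eta.
  move=> pe; rewrite /hl; apply: cvgMl_tmp.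
  under eq_fun do rewrite lapMn//.
  have a1 : admissible (fun x => 1%:R * \1_A x : R)%R by exact: admissible_indic.
  have dfin : deval eta A \is a fin_num.
    rewrite -dint_indic; have -> : \1_A = (fun x => 1%:R * \1_A x : R)%R.
      by apply/funext => x; rewrite mul1r.
    exact: dint_fin.
  have d0 : (0 <= fine (deval eta A))%R.
    apply: fine_ge0; rewrite -dint_indic; apply: (dint_ge0 pe (measurable_indic mA)).
    by move=> x; rewrite indicE ler0n.
  have -> : \1_[set eta : D | (y%:E < deval eta A)%E] eta =
      (if (expR (- fine (deval eta A)) < c)%R then 1 else 0)%R :> R.
    rewrite indicE /c ltr_expR ltrN2 -lte_fin (fineK dfin).
    case: ifPn => [yd|/negP yd]; first by rewrite mem_set.
    by rewrite memNset.
  apply: cvg_step; last exact: expR_gt0.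
  by rewrite expR_ge0/= -expR0 ler_expR oppr_le0.
have l1 := lapint_cvg Q1pos Q1fin af mh_ mhl h_01 lim.
have l2 := lapint_cvg Q2pos Q2fin af mh_ mhl h_01 lim.
have e : (fun n => lapint Q1 f (h_ n)) = (fun n => lapint Q2 f (h_ n)).
  by apply/funext => n; exact: agree_step.
rewrite e in l1; exact: cvg_unique l1 l2.
Qed.

(** Inductive rather than an intersection over a list, so that [agree] reaches
    every member of this pi-system by one application of [agree_cut] for each
    event. *)
Inductive cut : set (set D) :=
| cutT : cut setT
| cutI S A (y : R) : cut S -> measurable A ->
    cut (S `&` [set eta | y%:E < deval eta A]).

Lemma cut_setI : setI_closed cut.
Proof.
move=> S S' cS; elim=> [|S'' A y _ ih mA]; first by rewrite setIT.
by rewrite setIA; exact: cutI.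
Qed.

Lemma measurable_cut S : cut S -> measurable S.
Proof.
elim=> [//|S' A y _ mS' mA]; apply: measurableI => //.
rewrite -[X in measurable X]setTI; apply: emeasurable_fun_o_infty => //.
exact: measurable_deval.
Qed.

Lemma measurable_cutE : (measurable : set (set D)) = <<s cut >>.
Proof.
apply/seteqP; split; last first.
  by apply: smallest_sub; [exact: sigma_algebra_measurable|exact: measurable_cut].
apply: smallest_sub; first exact: smallest_sigma_algebra.
move=> _ [A mA [B mB <-]].
have : measurable_fun [set: g_sigma_algebraType cut]
    (deval ^~ A : g_sigma_algebraType cut -> \bar R).
  apply: (measurability _ (ErealGenOInfty.measurableE R)) => //.
  move=> _ [_ [y ->] <-]; apply: sub_sigma_algebra.
  rewrite (_ : _ `&` _ = setT `&` [set eta : D | y%:E < deval eta A]).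
    exact: cutI cutT mA.
  by apply/seteqP; split => eta /=; rewrite in_itv/= andbT.
by move=> /(_ measurableT _ mB).
Qed.

Lemma laplace_unique :
  (forall f, admissible f ->
    \int[Q1]_eta expeR (- dint eta f) = \int[Q2]_eta expeR (- dint eta f)) ->
  forall B, measurable B -> Q1 B = Q2 B.
Proof.
move=> Q12; have agree1 : agree (cst 1%R).
  move=> f af; have [mf _ _] := af.
  have E (Q : {measure set D -> \bar R}) : {ae Q, forall eta : D, dpositive eta} ->
      lapint Q f (cst 1%R) = \int[Q]_eta expeR (- dint eta f).
    move=> Qp; apply: ge0_ae_eq_integral => //.
    - exact: measurable_laph.
    - apply: measurableT_comp; first exact: measurable_expeR.
      by apply: measurableT_comp => //; exact: measurable_dint.
    - by move=> eta _; rewrite lee_fin mulr1; case/andP: (lap01 f eta).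
    - by move=> eta _; exact: expeR_ge0.
    - by apply: filterS Qp => eta pe _; rewrite mulr1 lapE.
  by rewrite !E//; exact: Q12.
have agreeS S : cut S -> agree \1_S.
  elim=> [|S' A y cS' aS' mA]; first by rewrite indicT.
  rewrite indicI; apply: agree_cut => //.
  - by apply: measurable_indic; exact: measurable_cut.
  - by move=> eta; rewrite indicE; case: (_ \in _); rewrite ?lexx ler01.
apply: (measure_unique cut (fun=> setT)) => //.
- exact: measurable_cutE.
- exact: cut_setI.
- by move=> _; exact: cutT.
- by rewrite bigcup_const//; exists 0%N.
move=> S cS; have mS := measurable_cut cS.
pose f0 (x : X) : R := (0%N%:R * \1_setT x)%R.
have a0 : admissible f0 := admissible_indic R 0%N measurableT.
have E (Q : {measure set D -> \bar R}) : {ae Q, forall eta : D, dpositive eta} ->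
    lapint Q f0 \1_S = Q S.
  move=> Qp; rewrite -[in RHS](setIT S) -integral_indic//.
  apply: ge0_ae_eq_integral => //.
  - by apply: measurable_laph; [case: a0|exact: measurable_indic].
  - by apply/measurable_EFinP; exact: measurable_indic.
  - move=> eta _; rewrite lee_fin mulr_ge0//.
    by case/andP: (lap01 f0 eta).
  - by apply: (filterS _ Qp) => eta pe _; rewrite /f0 lapMn// expr0 mul1r.
by have := agreeS _ cS _ a0; rewrite !E.
Qed.

End laplace_unique.

(** * The gamma measure *)

Section dpositive_ae.
Context (R : realType) d (X : measurableType d).
Local Notation D := (dmeasure R X).

Lemma ppart_eq0 (g : X -> R) A x : ppart g A = 0 -> A x -> (g x <= 0)%R.
Proof.
move=> gA0 Ax; rewrite -lee_fin; have -> : 0%:E = ppart g A by rewrite gA0.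
apply: esum_ge; exists [set x]; last by rewrite fsbig_set1 lee_fin le_max lexx.
by split; [exact: finite_set1|move=> _ ->].
Qed.

Lemma measurable_dpositive : standard_borel R X ->
  measurable (dpositive : set D).
Proof.
move=> sX; rewrite (_ : dpositive =
    setT `&` [set eta : D | ppart (\- mass eta)%R setT <= 0]).
  by apply: emeasurable_fun_infty_c => //; exact: measurable_ppartN_mass.
rewrite setTI; apply/seteqP; split => eta /= pe.
  by rewrite /ppart esum1// => x _; congr (_%:E); apply/max_idPr; rewrite oppr_le0.
move=> x; rewrite -oppr_le0; apply: (@ppart_eq0 (\- mass eta)%R setT) => //.
by apply/eqP; rewrite eq_le pe measure_ge0.
Qed.

End dpositive_ae.

Section gamma_laplace.
Context (R : realType) d (X : measurableType d).
Local Notation D := (dmeasure R X).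
Implicit Types (f g a : X -> R) (A : set X).
Variables (nu : {finite_measure set X -> \bar R}) (P : probability D R).
Hypotheses (sX : standard_borel R X) (Pgamma : gamma_measure nu P).

Let Ppos : {ae P, forall eta : D, dpositive eta} := Pgamma.1.

Let measurable_ln1 g : measurable_fun [set: X] g ->
  measurable_fun [set: X] (fun x => (ln (1 + g x))%:E).
Proof.
move=> mg; apply/measurable_EFinP; apply: measurableT_comp.
  exact: measurable_ln.
by apply: measurable_funD.
Qed.

Let expN_le1 (x : \bar R) : 0 <= x -> expeR (- x) <= 1.
Proof. by move=> x0; rewrite -expeR0 lee_expeR oppe_le0. Qed.

(** The formula extends to unbounded g by truncation and monotone convergence;
    both sides may vanish. *)
Lemma laplace_ge0 g : measurable_fun [set: X] g -> (forall x, 0 <= g x)%R ->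
  \int[P]_eta expeR (- dint eta g) =
  expeR (- \int[nu]_x (ln (1 + g x))%:E).
Proof.
move=> mg g0; pose g_ (n : nat) x := Num.min (g x) n%:R.
have mg_ n : measurable_fun [set: X] (g_ n).
  by apply: (@measurable_minr _ _ _ _ g (cst n%:R)).
have g_0 n x : (0 <= g_ n x)%R by rewrite le_min g0 ler0n.
have g_nd x m n : (m <= n)%N -> (g_ m x <= g_ n x)%R.
  by move=> mn; rewrite le_min ge_min lexx/= ge_min ler_nat mn orbT.
have g_cvg x : \forall n \near \oo, g_ n x = g x.
  exists (Num.truncn (g x)).+1 => // n /= gn.
  apply/min_idPl; apply/ltW; apply: (lt_le_trans (truncnS_gt _)).
  by rewrite ler_nat.
have gamma_n n : \int[P]_eta expeR (- dint eta (g_ n)) =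
    expeR (- \int[nu]_x (ln (1 + g_ n x))%:E).
  by apply: Pgamma.2 => //; exists n%:R => x; rewrite ge_min lexx orbT.
have cvg_nu : (fun n => \int[nu]_x (ln (1 + g_ n x))%:E) @ \oo -->
    \int[nu]_x (ln (1 + g x))%:E.
  have -> : \int[nu]_x (ln (1 + g x))%:E =
      \int[nu]_x limn (fun n => (ln (1 + g_ n x))%:E).
    apply: eq_integral => x _; apply/esym/cvg_lim => //.
    apply: cvg_near_cst; apply: filterS (g_cvg x) => n /= ->; by [].
  apply: cvg_monotone_convergence => //.
  - by move=> n; exact: measurable_ln1.
  - by move=> n x _; rewrite lee_fin ln_ge0// lerDl.
  - move=> x _ m n mn; rewrite lee_fin ler_ln ?posrE ?ltr_wpDr// lerD2l.
    exact: g_nd.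
have nd_nu : {homo (fun n => \int[nu]_x (ln (1 + g_ n x))%:E) :
    m n / (m <= n)%N >-> m <= n}.
  move=> m n mn; apply: ge0_le_integral => //.
  - by move=> x _; rewrite lee_fin ln_ge0// lerDl.
  - exact: measurable_ln1.
  - exact: measurable_ln1.
  - move=> x _; rewrite lee_fin ler_ln ?posrE ?ltr_wpDr// lerD2l.
    exact: g_nd.
have rhs := cvg_expeRN nd_nu cvg_nu.
have dint_cvg eta : dpositive eta ->
    (fun n => expeR (- dint eta (g_ n))) @ \oo --> expeR (- dint eta g).
  move=> pe; apply: cvg_expeRN.
    by move=> m n mn; apply: dint_le => // x; exact: g_nd.
  under eq_fun do rewrite dintE//.
  rewrite dintE// (_ : \int[_]_x (g x)%:E =
      \int[ppart (mass eta)]_x limn (fun n => (g_ n x)%:E)); last first.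
    apply: eq_integral => x _; apply/esym/cvg_lim => //.
    apply: cvg_near_cst; apply: filterS (g_cvg x) => n /= ->; by [].
  apply: cvg_monotone_convergence => //.
  - by move=> n; exact/measurable_EFinP.
  - by move=> n x _; rewrite lee_fin.
  - by move=> x _ m n mn; rewrite lee_fin; exact: g_nd.
have [//|||_ _ lhs] := @dominated_convergence _ _ _ P setT measurableT
  (fun n eta => expeR (- dint eta (g_ n))) (fun eta => expeR (- dint eta g))
  (cst 1) (fun n => measurable_expeRN_dint sX (mg_ n)) (measurable_expeRN_dint sX mg).
- by apply: (filterS _ Ppos) => eta pe _; exact: dint_cvg.
- exact: finite_measure_integrable_cst.
- apply: (filterS _ Ppos) => eta pe n _.
  by rewrite gee0_abs ?expeR_ge0// expN_le1// dint_ge0.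
apply: (cvg_unique _ lhs) => //.
by rewrite /=; under eq_fun do rewrite gamma_n.
Qed.

(** Where the integral of g is infinite, so is that of g/(n+1), and its
    exponential vanishes. Hence the probability that it is finite is at least
    exp (- \int log (1 + g/(n+1))), which tends to 1. *)
Lemma ae_dint_lty g : measurable_fun [set: X] g -> (forall x, 0 <= g x)%R ->
  \int[nu]_x (ln (1 + g x))%:E < +oo ->
  {ae P, forall eta : D, dint eta g < +oo}.
Proof.
move=> mg g0 goo; pose N := [set eta : D | dint eta g < +oo].
have mN : measurable N.
  rewrite -[X in measurable X]setTI; apply: emeasurable_fun_infty_o => //.
  exact: measurable_dint.
suff PN : 1 <= P N.
  apply/negligibleP; first exact: measurableC.
  have := probability_setC P mN; rewrite (_ : P N = 1) ?subee//.
  by apply/eqP; rewrite eq_le PN probability_le1.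
pose g_ (n : nat) x := (n.+1%:R^-1 * g x)%R.
have n0 n : (0 < n.+1%:R^-1 :> R)%R by rewrite invr_gt0.
have mg_ n : measurable_fun [set: X] (g_ n) by exact: measurable_funM.
have g_0 n x : (0 <= g_ n x)%R by rewrite mulr_ge0// ltW.
pose I n := \int[nu]_x (ln (1 + g_ n x))%:E.
have PN n : 1 - I n <= P N.
  apply: (le_trans (expeR_ge1Dx _)); rewrite -laplace_ge0//.
  rewrite -[X in P X]setIT -integral_indic//; apply: ae_ge0_le_integral => //.
  - by move=> eta _; exact: expeR_ge0.
  - exact: measurable_expeRN_dint.
  - by apply/measurable_EFinP; exact: measurable_indic.
  apply: (filterS _ Ppos) => eta pe _; rewrite indicE.
  have [Neta|Neta] := pselect (N eta).
    by rewrite mem_set// expN_le1// dint_ge0.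
  rewrite memNset// dintZ ?(ltW (n0 n))//.
  have -> : dint eta g = +oo by apply/eqP; move/negP: Neta; rewrite -leNgt leye_eq.
  by rewrite mulry gtr0_sg// mul1e.
have Icvg : I @ \oo --> 0.
  have [//|||_ _] := @dominated_convergence _ _ _ nu setT measurableT
    (fun n x => (ln (1 + g_ n x))%:E) (cst 0) (fun x => (ln (1 + g x))%:E)
    (fun n => measurable_ln1 (mg_ n)) (measurable_cst _).
  - apply: aeW => x _; apply: cvg_EFin; first by near=> n.
    apply: (@squeeze_cvgr _ _ _ _ (cst 0%R) (fun n => n.+1%:R^-1 * g x)%R).
    + near=> n; rewrite ln_ge0 ?lerDl//=.
      by apply: le_ln1Dx; apply: lt_le_trans (g_0 n x); rewrite ltrN10.
    + exact: cvg_cst.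
    + have : (fun n => n.+1%:R^-1 * g x)%R @ \oo --> (0 * g x)%R.
        by apply: cvgMr_tmp; exact: cvg_harmonic.
      by rewrite mul0r.
  - apply/integrableP; split; first exact: measurable_ln1.
    under eq_integral do rewrite gee0_abs ?lee_fin ?ln_ge0 ?lerDl//.
    exact: goo.
  - apply: aeW => x n _; rewrite gee0_abs ?lee_fin ?ln_ge0 ?lerDl//.
    rewrite ler_ln ?posrE ?ltr_wpDr// lerD2l.
    by rewrite ler_piMl// invf_le1// ler1n.
  by rewrite integral0.
have : (fun n => 1 - I n) @ \oo --> 1 - 0.
  by apply: cvgeB => //; exact: cvg_cst.
rewrite sube0; apply: cvge_le.
by near=> n; exact: PN.
Unshelve. all: by end_near. Qed.

(** The transform at the indicator of A is 1 while its integrand is at most 1, so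
    the integrand is almost surely 1 and A has no mass. *)
Lemma ae_null A : measurable A -> nu A = 0 ->
  {ae P, forall eta : D, forall x, A x -> mass eta x = 0%R}.
Proof.
move=> mA A0; have m1 : measurable_fun [set: X] (\1_A : X -> R).
  exact: measurable_indic.
have i0 x : (0 <= \1_A x :> R)%R by rewrite indicE ler0n.
have mE := measurable_expeRN_dint sX m1.
have int1 : \int[P]_eta expeR (- dint eta \1_A) = 1.
  rewrite laplace_ge0// (_ : \int[nu]_x _ = 0) ?oppe0 ?expeR0//.
  rewrite (ge0_negligible_integral mA)//; last 2 first.
    + exact: measurable_ln1.
    + by move=> x _; rewrite lee_fin ln_ge0// lerDl.
  apply: integral0_eq => x [_ nAx].
  by rewrite indicE memNset// addr0 ln1.
pose k eta := (1 - lap (\1_A : X -> R) eta)%R.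
have mk : measurable_fun [set: D] k.
  by apply: measurable_funB => //; exact: measurable_lap.
have k0 eta : (0 <= k eta)%R by rewrite subr_ge0; case/andP: (lap01 (\1_A : X -> R) eta).
have a1 : admissible (\1_A : X -> R).
  by split=> //; exists 1%R => x; rewrite indicE; case: (_ \in _).
have intk : \int[P]_eta `|(k eta)%:E| = 0.
  have : \int[P]_eta (`|(k eta)%:E| + (lap (\1_A : X -> R) eta)%:E) = 1.
    under eq_integral do rewrite gee0_abs ?lee_fin// -EFinD subrK.
    by rewrite (integral_cst _ _ 1)// mul1e; exact: probability_setT.
  rewrite ge0_integralD//; last 3 first.
  - by apply: measurableT_comp => //; exact/measurable_EFinP.
  - by move=> eta _; rewrite lee_fin; case/andP: (lap01 (\1_A : X -> R) eta).
  - by apply/measurable_EFinP; exact: measurable_lap.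
  have -> : \int[P]_eta (lap (\1_A : X -> R) eta)%:E = 1.
    rewrite -int1; apply: ge0_ae_eq_integral => //.
    - by apply/measurable_EFinP; exact: measurable_lap.
    - by move=> eta _; rewrite lee_fin; case/andP: (lap01 (\1_A : X -> R) eta).
    - by move=> eta _; exact: expeR_ge0.
    - by apply: (filterS _ Ppos) => eta pe _; rewrite lapE.
  by move=> /(congr1 (fun y => y - 1)); rewrite addeK// subee.
have /(ae_eq_integral_abs _ _ _).1 := intk.
move=> /(_ measurableT); have mEk : measurable_fun [set: D] (EFin \o k).
  exact/measurable_EFinP.
move=> /(_ mEk) kae; apply: filterS2 Ppos kae => eta pe /(_ I) /= [].
rewrite /k => /eqP; rewrite subr_eq0 => /eqP l1 x Ax.
have d0 : dint eta \1_A = 0.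
  apply: oppe_inj; apply: expeR_inj; rewrite -lapE// -l1.
  by rewrite oppe0 expeR0.
apply/eqP; rewrite eq_le pe andbT; apply: (@ppart_eq0 _ _ _ _ A) => //.
rewrite ppart_indic// -(_ : dint eta \1_A = ppart (\1_A \* mass eta)%R setT)//.
by rewrite dintE// integral_ppart_fin.
Qed.

End gamma_laplace.

(** * Quasi-invariance *)

Section signed_dint.
Context (R : realType) d (X : measurableType d).
Implicit Types (f g u v : X -> R) (eta : dmeasure R X).

(** Since (u - v)^+ + v = (u - v)^- + u, additivity for non-negative functions
    suffices, even when the integral of u is infinite. *)
Lemma dintB u v eta : dpositive eta ->
  measurable_fun [set: X] u -> (forall x, 0 <= u x)%R ->
  measurable_fun [set: X] v -> (forall x, 0 <= v x)%R -> dint eta v < +oo ->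
  dint eta (u \- v)%R = dint eta u - dint eta v.
Proof.
move=> pe mu u0 mv v0 voo; have muv := measurable_funB mu mv.
pose p x := Num.max (u x - v x)%R 0%R; pose q x := Num.max (v x - u x)%R 0%R.
have mp : measurable_fun [set: X] p.
  exact: (@measurable_maxr _ _ _ _ (u \- v)%R (cst 0%R)).
have mq : measurable_fun [set: X] q.
  by apply: (@measurable_maxr _ _ _ _ (v \- u)%R (cst 0%R)) => //; exact: measurable_funB.
have p0 x : (0 <= p x)%R by rewrite le_max lexx orbT.
have q0 x : (0 <= q x)%R by rewrite le_max lexx orbT.
have pq x : (u x - v x = p x - q x)%R.
  rewrite /p /q; case: leP => h1; case: leP => h2; lra.
have -> : dint eta (u \- v)%R = dint eta p - dint eta q.
  rewrite !dintE// integralE; congr (_ - _); apply: eq_integral => x _.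
    by rewrite funeposE -EFin_max.
  by rewrite funenegE -EFinN -EFin_max /= opprB.
have e : dint eta p + dint eta v = dint eta q + dint eta u.
  rewrite -!dintD//; congr dint; apply/funext => x /=.
  by have := pq x; lra.
have qv : dint eta q <= dint eta v.
  by apply: dint_le => // x; rewrite /q ge_max v0 andbT lerBlDr lerDl.
have vfin : dint eta v \is a fin_num by rewrite ge0_fin_numE// dint_ge0.
have qfin : dint eta q \is a fin_num.
  by rewrite ge0_fin_numE ?dint_ge0// (le_lt_trans qv).
have -> : dint eta u = dint eta p + dint eta v - dint eta q.
  by rewrite e addeAC subee// add0e.
by rewrite [RHS]addeAC (addeK _ vfin).
Qed.

End signed_dint.

Section pushforward_density.
Context (R : realType) d (X : measurableType d).
Local Notation D := (dmeasure R X).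
Implicit Types (f g : X -> R).
Variable P : probability D R.
Hypotheses (sX : standard_borel R X).
Hypothesis Ppos : {ae P, forall eta : D, dpositive eta}.
Variables (a : X -> R) (dens : D -> \bar R).
Hypotheses (ma : measurable_fun [set: X] a) (a0 : forall x, (0 <= a x)%R).
Hypothesis adom : {ae P, forall eta : D, multdom a eta}.
Hypotheses (mdens : measurable_fun [set: D] dens) (dens0 : forall eta, 0 <= dens eta).

Let mmult : measurable_fun [set: D] (mult a).
Proof. exact: measurable_mult. Qed.

Let Ppos0 : P (~` dpositive) = 0.
Proof.
by apply/negligibleP => //; apply: measurableC; exact: measurable_dpositive.
Qed.

(** Both sides are finite measures carried by the positive discrete measures, and
    the hypothesis says that they have the same Laplace transform, since the
    integral of f against [mult a eta] is that of f times a against eta. *)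
Lemma pushforward_density :
  (forall f, admissible f ->
    \int[P]_eta (expeR (- dint eta f) * dens eta) =
    \int[P]_eta expeR (- dint eta (f \* a)%R)) ->
  forall B, measurable B -> P (mult a @^-1` B) = \int[P]_(eta in B) dens eta.
Proof.
move=> lap_dens.
have [Q [QE Qint]] := density_measure P mdens dens0.
have mC : measurable (~` dpositive : set D).
  by apply: measurableC; exact: measurable_dpositive.
move=> B mB; rewrite -QE//.
apply: (@laplace_unique _ _ _ sX (pushforward P (mult a)) Q _ _ _ _ _ B mB).
- exists (~` dpositive); split => //; apply/eqP; rewrite eq_le measure_ge0 andbT.
  have := Ppos0; rewrite /pushforward => <-.
  apply: (@le_measure _ _ _ P); rewrite ?inE//.
    by rewrite -[X in measurable X]setTI; apply: mmult.
  by move=> eta /= npe pe; apply: npe; exact: dpositive_mult.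
- exists (~` dpositive); split => //; rewrite QE//.
  by apply: null_set_integral => //; exact: measurable_funTS.
- by change (P setT < +oo); rewrite probability_setT ltry.
- have az : admissible (fun _ : X => 0%R : R) by split => //; exists 0%R.
  have dens1 : \int[P]_eta dens eta =
      \int[P]_eta (expeR (- dint eta (fun=> 0%R)) * dens eta).
    by apply: eq_integral => eta _; rewrite dint0 oppe0 expeR0 mul1e.
  have one : \int[P]_eta expeR (- dint eta ((fun=> 0) \* a)%R) = 1.
    rewrite -(probability_setT P) -[RHS]mul1e -integral_cst//.
    apply: eq_integral => eta _.
    have -> : ((fun=> 0) \* a)%R = (fun=> 0%R) :> (X -> R).
      by apply/funext => x /=; rewrite mul0r.
    by rewrite dint0 oppe0 expeR0.
  by rewrite QE// dens1 lap_dens// one ltry.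
move=> f af; have [mf f0 _] := af.
rewrite ge0_integral_pushforward//; last 2 first.
- exact: measurable_expeRN_dint.
- by move=> eta _; exact: expeR_ge0.
rewrite Qint; [|exact: measurable_expeRN_dint|by move=> eta; exact: expeR_ge0].
rewrite lap_dens// preimage_setT; apply: ge0_ae_eq_integral => //.
- by apply: (measurableT_comp (measurable_expeRN_dint sX mf)).
- by apply: (measurable_expeRN_dint sX); exact: measurable_funM.
- by move=> eta _; exact: expeR_ge0.
- by move=> eta _; exact: expeR_ge0.
- by apply: (filterS _ adom) => eta ae _ /=; rewrite dint_mult.
Qed.

Lemma integral_comp_mult G :
  (forall B, measurable B -> P (mult a @^-1` B) = \int[P]_(eta in B) dens eta) ->
  measurable_fun [set: D] G -> (forall eta, 0 <= G eta) ->
  \int[P]_eta G (mult a eta) = \int[P]_eta (G eta * dens eta).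
Proof.
move=> PB mG G0; have [Q [QE Qint]] := density_measure P mdens dens0.
rewrite -Qint// -(preimage_setT (mult a)) -(ge0_integral_pushforward mmult P)//.
apply: eq_measure_integral => B mB _.
by rewrite QE// -PB.
Qed.

End pushforward_density.

Section gamma_quasi_invariance.
Context (R : realType) d (X : measurableType d).
Local Notation D := (dmeasure R X).
Implicit Types (f g a b : X -> R).
Variables (nu : {finite_measure set X -> \bar R}) (P : probability D R).
Hypotheses (sX : standard_borel R X) (Pgamma : gamma_measure nu P).

Let Ppos : {ae P, forall eta : D, dpositive eta} := Pgamma.1.

(** Functions with summable logarithm that vanish nowhere. For these [tilde a] is
    the honest 1/a - 1; zeros are dealt with in the main theorem. *)
Definition pos_log_summable a := [/\ measurable_fun [set: X] a,
  forall x, (0 < a x)%R & nu.-integrable [set: X] (fun x => (ln (a x))%:E)].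

Let measurable_inv f : measurable_fun [set: X] f ->
  measurable_fun [set: X] (fun x => (f x)^-1)%R.
Proof. by move=> mf; apply: measurableT_comp mf; exact: measurable_invr. Qed.

Let measurable_tilde f : measurable_fun [set: X] f ->
  measurable_fun [set: X] (tilde f).
Proof. by move=> mf; apply: measurable_funB => //; exact: measurable_inv. Qed.

Let measurable_lnE f : measurable_fun [set: X] f ->
  measurable_fun [set: X] (fun x => (ln (f x))%:E).
Proof.
by move=> mf; apply/measurable_EFinP; apply: measurableT_comp mf; exact: measurable_ln.
Qed.

Lemma pos_log_summableV a : pos_log_summable a ->
  pos_log_summable (fun x => (a x)^-1)%R.
Proof.
move=> [ma a0 ia]; split; first exact: measurable_inv.
  by move=> x; rewrite invr_gt0.
apply: (eq_integrable _ _ _ _ (integrableN ia)) => // x _ /=.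
by rewrite lnV ?posrE.
Qed.

Lemma ae_dint_log_summable a : pos_log_summable a ->
  {ae P, forall eta : D, dint eta a < +oo}.
Proof.
move=> [ma a0 ia]; apply: (ae_dint_lty sX Pgamma) => // [x|]; first exact: ltW.
have ib : nu.-integrable [set: X] (fun x => (ln 2)%:E + `|(ln (a x))%:E|).
  apply: integrableD => //; first exact: finite_measure_integrable_cst.
  exact: integrable_abse ia.
have l2 : (0 <= ln 2 :> R)%R by rewrite ln_ge0// ler1n.
apply: le_lt_trans (integrable_lty _ ib) => //.
apply: ge0_le_integral => //.
- by move=> x _; rewrite lee_fin ln_ge0// lerDl ltW.
- by apply: measurable_lnE; exact: measurable_funD.
- exact: (measurable_int _ ib).
move=> x _; rewrite -EFinD lee_fin.
have [a1|/ltW a1] := leP (a x) 1%R.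
  apply: (@le_trans _ _ (ln 2)); last by rewrite lerDl.
  by rewrite ler_ln ?posrE ?ltr_wpDr ?(ltW (a0 x))//; lra.
rewrite ger0_norm ?ln_ge0// -lnM ?posrE//.
by rewrite ler_ln ?posrE ?mulr_gt0 ?ltr_wpDr ?(ltW (a0 x))//; lra.
Qed.

Lemma ae_multdom a : pos_log_summable a -> {ae P, forall eta : D, multdom a eta}.
Proof.
move=> la; apply: filterS2 Ppos (ae_dint_log_summable la) => eta pe.
by apply: multdom_dint => // x; apply: ltW; case: la.
Qed.

Lemma mult_densityE a : (forall x, 0 < a x)%R ->
  mult_density nu a = fun eta =>
    expeR (- \int[nu]_x (ln (a x))%:E) * expeR (- dint eta (tilde a)).
Proof.
move=> a0; apply/funext => eta; rewrite /mult_density; congr (expeR (- _) * _).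
by apply: eq_integral => x _; rewrite lne_EFin.
Qed.

Lemma measurable_mult_density a : measurable_fun [set: X] a ->
  measurable_fun [set: D] (mult_density nu a).
Proof.
move=> ma; apply: emeasurable_funM => //.
by apply: (measurable_expeRN_dint sX); exact: measurable_tilde.
Qed.

Lemma mult_density_ge0 a (eta : D) : 0 <= mult_density nu a eta.
Proof. by rewrite mule_ge0// expeR_ge0. Qed.

Lemma dint_tilde a f (eta : D) : dpositive eta -> measurable_fun [set: X] a ->
  (forall x, 0 < a x)%R -> admissible f ->
  dint eta (f \+ tilde a)%R = dint eta f + dint eta (tilde a).
Proof.
move=> pe ma a0 [mf f0 _].
have mV := measurable_inv ma.
have V0 x : (0 <= (a x)^-1)%R by rewrite invr_ge0 ltW.
have m1 : measurable_fun [set: X] (cst 1%R : X -> R) by [].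
have oo1 : dint eta (cst 1%R) < +oo by apply: (@dint_lty _ _ _ _ _ 1%R).
have -> : (f \+ tilde a)%R = ((f \+ (fun x => (a x)^-1)) \- cst 1)%R.
  by apply/funext => x /=; rewrite /tilde addrA.
rewrite dintB//; [|exact: measurable_funD|by move=> x; rewrite addr_ge0].
rewrite (_ : tilde a = (fun x => (a x)^-1) \- cst 1)%R// dintB//.
by rewrite dintD// [RHS]addeA.
Qed.

(** Reduces the density formula to the value of the Laplace transform at
    f + 1/a - 1, a function which can be negative when a > 1. *)
Lemma mult_density_of_laplace a : pos_log_summable a ->
  (forall f, admissible f -> \int[P]_eta expeR (- dint eta (f \+ tilde a)%R) =
    expeR (\int[nu]_x (ln (a x))%:E) *
    expeR (- \int[nu]_x (ln (1 + f x * a x))%:E)) ->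
  forall B, measurable B ->
    P (mult a @^-1` B) = \int[P]_(eta in B) mult_density nu a eta.
Proof.
move=> la; have [ma a0 ia] := la => H.
apply: pushforward_density => //.
- by move=> x; exact: ltW.
- exact: ae_multdom.
- exact: measurable_mult_density.
- exact: mult_density_ge0.
move=> f af; have [mf f0 _] := af.
have mfa := measurable_funM mf ma.
have mft : measurable_fun [set: X] (f \+ tilde a)%R.
  by apply: measurable_funD => //; exact: measurable_tilde.
rewrite (laplace_ge0 sX Pgamma)//; last by move=> x; rewrite mulr_ge0// ltW.
set L := \int[nu]_x (ln (a x))%:E in H *.
have Lfin : L \is a fin_num by exact: integrable_fin_num.
transitivity (expeR (- L) * \int[P]_eta expeR (- dint eta (f \+ tilde a)%R)).
  rewrite -ge0_integralZl//; last 3 first.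
  - exact: measurable_expeRN_dint.
  - by move=> eta _; exact: expeR_ge0.
  - exact: expeR_ge0.
  apply: ge0_ae_eq_integral => //.
  - apply: emeasurable_funM; first exact: measurable_expeRN_dint.
    exact: measurable_mult_density.
  - by apply: emeasurable_funM => //; exact: measurable_expeRN_dint.
  - by move=> eta _; rewrite mule_ge0 ?expeR_ge0 ?mult_density_ge0.
  - by move=> eta _; rewrite mule_ge0 ?expeR_ge0.
  apply: (filterS _ Ppos) => eta pe _.
  rewrite dint_tilde// (@oppeD _ (dint eta f)) ?fin_num_adde_defr ?dint_fin//.
  rewrite expeRD mult_densityE// -/L.
  by rewrite muleCA.
rewrite H// muleA -expeRD addeC subee// expeR0 mul1e.
by congr (expeR (- _)).
Qed.

(** Here 1/a - 1 >= 0, so the defining formula of the gamma measure applies, and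
    1 + f + 1/a - 1 = (1 + f a) / a. *)
Lemma laplace_tilde_le1 a f : pos_log_summable a -> (forall x, a x <= 1)%R ->
  admissible f -> \int[P]_eta expeR (- dint eta (f \+ tilde a)%R) =
    expeR (\int[nu]_x (ln (a x))%:E) *
    expeR (- \int[nu]_x (ln (1 + f x * a x))%:E).
Proof.
move=> [ma a0 ia] a1 [mf f0 _].
have mfa := measurable_funM mf ma.
have lna0 x : (0 <= - ln (a x))%R by rewrite oppr_ge0 ln_le0.
rewrite (laplace_ge0 sX Pgamma); last 2 first.
- by apply: measurable_funD => //; exact: measurable_tilde.
- by move=> x; rewrite addr_ge0// subr_ge0 invf_ge1.
have -> : \int[nu]_x (ln (1 + (f x + tilde a x)))%:E =
    \int[nu]_x (ln (1 + f x * a x))%:E + \int[nu]_x (- ln (a x))%:E.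
  rewrite -ge0_integralD//; last 4 first.
  - by move=> x _; rewrite lee_fin ln_ge0// lerDl mulr_ge0// ltW.
  - by apply: measurable_lnE; exact: measurable_funD.
  - by move=> x _; rewrite lee_fin.
  - apply/measurable_EFinP; apply: measurable_funN.
    by apply: measurableT_comp ma; exact: measurable_ln.
  apply: eq_integral => x _; rewrite -EFinD; congr (_%:E).
  have p1 : (0 < 1 + f x * a x)%R by rewrite ltr_wpDr// mulr_ge0// ltW.
  rewrite -lnV ?posrE// -lnM ?posrE ?invr_gt0//; congr ln.
  rewrite /tilde mulrDl mul1r -mulrA divff ?gt_eqF//; ring.
have <- : - (\int[nu]_x (- ln (a x))%:E) = \int[nu]_x (ln (a x))%:E.
  rewrite -integral_ge0N; last by move=> x _; rewrite lee_fin.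
  by apply: eq_integral => x _; rewrite -EFinN opprK.
have fin : \int[nu]_x (- ln (a x))%:E \is a fin_num.
  by apply: integrable_fin_num => //; exact: (integrableN ia).
by rewrite fin_num_oppeD// expeRD muleC.
Qed.

(** Write a = a1 / b with a1 = min (a, 1) and b = 1 / max (a, 1), so that
    f + 1/a - 1 = g - (1 - b) with g = f + 1/a1 - 1 >= 0. The density of the
    image under the multiplicator by b <= 1 is known from
    [laplace_tilde_le1]. Applied to
    G eta = exp (- \int g/b d eta + \int (1/b - 1) d eta)
    it gives the claim: composing G with the multiplicator produces
    exp (- \int (g - (1 - b)) d eta), and multiplying G by the density cancels
    the exponential with positive exponent and leaves a Laplace transform at the
    non-negative function g/b. *)
Lemma laplace_tilde a f : pos_log_summable a -> admissible f ->
  \int[P]_eta expeR (- dint eta (f \+ tilde a)%R) =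
    expeR (\int[nu]_x (ln (a x))%:E) *
    expeR (- \int[nu]_x (ln (1 + f x * a x))%:E).
Proof.
move=> [ma a0 ia] af; have [mf f0 _] := af.
pose a1 x := Num.min (a x) 1%R; pose b x := (Num.max (a x) 1)^-1%R.
have ma1 : measurable_fun [set: X] a1.
  exact: (@measurable_minr _ _ _ _ a (cst 1%R)).
have mb : measurable_fun [set: X] b.
  by apply: measurable_inv; exact: (@measurable_maxr _ _ _ _ a (cst 1%R)).
have a10 x : (0 < a1 x)%R by rewrite lt_min a0 ltr01.
have a11 x : (a1 x <= 1)%R by rewrite ge_min lexx orbT.
have b0 x : (0 < b x)%R by rewrite invr_gt0 lt_max ltr01 orbT.
have b1 x : (b x <= 1)%R by rewrite invf_le1 ?le_max ?lexx ?orbT// lt_max ltr01 orbT.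
have a1b x : (a x = a1 x / b x)%R.
  by rewrite /a1 /b invrK; case: leP; rewrite ?mulr1 ?mul1r.
have tE x : (tilde a x = tilde a1 x - (1 - b x))%R.
  rewrite /tilde /a1 /b; case: leP => _; rewrite ?invr1; ring.
have lnE x : (ln (a x) = ln (a1 x) - ln (b x))%R by rewrite a1b ln_div ?posrE.
have lna1 x : (ln (a1 x) <= 0)%R by rewrite ln_le0.
have lnb x : (ln (b x) <= 0)%R by rewrite ln_le0.
have ab1 x : (a1 x = 1 \/ b x = 1)%R.
  by rewrite /a1 /b; case: leP => _; [right|left]; rewrite ?invr1.
have lna1b x : (ln (a1 x) = 0 \/ ln (b x) = 0)%R.
  by case: (ab1 x) => ->; rewrite ln1; [left|right].
have ia1 : nu.-integrable [set: X] (fun x => (ln (a1 x))%:E).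
  apply: (le_integrable measurableT _ _ ia); first exact: measurable_lnE.
  move=> x _; rewrite lee_fin (lnE x).
  by have [->|->] := lna1b x; rewrite ?normr0 ?subr0.
have ib : nu.-integrable [set: X] (fun x => (ln (b x))%:E).
  apply: (le_integrable measurableT _ _ ia); first exact: measurable_lnE.
  move=> x _; rewrite lee_fin (lnE x).
  by have [->|->] := lna1b x; rewrite ?normr0 ?sub0r ?normrN.
have sb : pos_log_summable b by [].
pose g := (f \+ tilde a1)%R.
have mt1 := measurable_tilde ma1; have mtb := measurable_tilde mb.
have t10 x : (0 <= tilde a1 x)%R by rewrite subr_ge0 invf_ge1.
have tb0 x : (0 <= tilde b x)%R by rewrite subr_ge0 invf_ge1.
have mg : measurable_fun [set: X] g by exact: measurable_funD.
have g0 x : (0 <= g x)%R by rewrite addr_ge0.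
pose h x := (g x / b x)%R.
have mh : measurable_fun [set: X] h.
  by apply: measurable_funM => //; exact: measurable_inv.
have h0 x : (0 <= h x)%R by rewrite divr_ge0// ltW.
pose c x := (1 - b x)%R.
have mc : measurable_fun [set: X] c by exact: measurable_funB.
have c0 x : (0 <= c x)%R by rewrite subr_ge0.
have c1 x : (c x <= 1)%R by rewrite lerBlDr lerDl ltW.
pose G (eta : D) := expeR (- dint eta h) * expeR (dint eta (tilde b)).
have mG : measurable_fun [set: D] G.
  apply: emeasurable_funM; first exact: measurable_expeRN_dint.
  apply: measurableT_comp; first exact: measurable_expeR.
  exact: measurable_dint.
have G0 eta : 0 <= G eta by rewrite mule_ge0 ?expeR_ge0.
have lap_b := mult_density_of_laplace sb (fun f' => laplace_tilde_le1 sb b1).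
have mGb : measurable_fun [set: D] (fun eta => G (mult b eta)).
  by apply: measurableT_comp mG _; exact: measurable_mult.
have lhs : \int[P]_eta expeR (- dint eta (f \+ tilde a)%R) =
    \int[P]_eta G (mult b eta).
  apply: ge0_ae_eq_integral => //.
  - apply: (measurable_expeRN_dint sX); apply: measurable_funD => //.
    exact: measurable_tilde.
  - by move=> eta _; exact: expeR_ge0.
  apply: filterS2 Ppos (ae_multdom sb) => eta pe be _.
  rewrite /G !dint_mult//.
  have -> : (h \* b)%R = g.
    by apply/funext => x /=; rewrite /h -mulrA mulVf ?mulr1// gt_eqF.
  have -> : (tilde b \* b)%R = c.
    by apply/funext => x /=; rewrite /tilde mulrBl mulVf ?mul1r// gt_eqF.
  have -> : (f \+ tilde a)%R = (g \- c)%R.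
    by apply/funext => x /=; rewrite tE /g /c /= addrA.
  have coo : dint eta c < +oo by exact: (dint_lty pe mc c0 c1).
  have cfin : dint eta c \is a fin_num by rewrite ge0_fin_numE// dint_ge0.
  rewrite dintB// -expeRD; congr expeR.
  by rewrite (@oppeB _ (dint eta g)) ?fin_num_adde_defl// fin_numN.
have rhs : \int[P]_eta (G eta * mult_density nu b eta) =
    expeR (- \int[nu]_x (ln (b x))%:E) * \int[P]_eta expeR (- dint eta h).
  rewrite -ge0_integralZl//; last 3 first.
  - exact: measurable_expeRN_dint.
  - by move=> eta _; exact: expeR_ge0.
  - exact: expeR_ge0.
  apply: ge0_ae_eq_integral => //.
  - by apply: emeasurable_funM => //; exact: measurable_mult_density.
  - by apply: emeasurable_funM => //; exact: measurable_expeRN_dint.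
  - by move=> eta _; rewrite mule_ge0// mult_density_ge0.
  - by move=> eta _; rewrite mule_ge0 ?expeR_ge0.
  apply: filterS2 Ppos (ae_dint_log_summable (pos_log_summableV sb)) => eta pe Voo _.
  have tboo : dint eta (tilde b) < +oo.
    apply: le_lt_trans Voo; apply: dint_le => //; first exact: measurable_inv.
    by move=> x; rewrite gerBl.
  have tbfin : dint eta (tilde b) \is a fin_num by rewrite ge0_fin_numE// dint_ge0.
  rewrite /G mult_densityE// muleCA -muleA; congr (_ * _).
  by rewrite -expeRD subee// expeR0 mule1.
rewrite lhs (integral_comp_mult sX mb _ _ lap_b)//; last 2 first.
- exact: measurable_mult_density.
- exact: mult_density_ge0.
rewrite rhs (laplace_ge0 sX Pgamma)//.
have -> : \int[nu]_x (ln (1 + h x))%:E =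
    \int[nu]_x (ln (1 + f x * a x))%:E + \int[nu]_x (- ln (a1 x))%:E.
  rewrite -ge0_integralD//; last 4 first.
  - by move=> x _; rewrite lee_fin ln_ge0// lerDl mulr_ge0// ltW.
  - apply: measurable_lnE; apply: measurable_funD => //.
    exact: measurable_funM.
  - by move=> x _; rewrite lee_fin oppr_ge0.
  - apply/measurable_EFinP; apply: measurable_funN.
    by apply: measurableT_comp ma1; exact: measurable_ln.
  apply: eq_integral => x _; rewrite -EFinD; congr (_%:E).
  have p1 : (0 < 1 + f x * a x)%R by rewrite ltr_wpDr// mulr_ge0// ltW.
  rewrite -lnV ?posrE// -lnM ?posrE ?invr_gt0//; congr ln.
  rewrite a1b /h /g /= /tilde.
  have a1n : a1 x != 0%R by rewrite gt_eqF.
  have bn : b x != 0%R by rewrite gt_eqF.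
  by have [->|->] := ab1 x; field; rewrite ?a1n ?bn ?oner_eq0.
have -> : \int[nu]_x (ln (a x))%:E =
    \int[nu]_x (ln (a1 x))%:E - \int[nu]_x (ln (b x))%:E.
  by rewrite -integralB//; apply: eq_integral => x _; rewrite lnE EFinB.
have <- : - (\int[nu]_x (- ln (a1 x))%:E) = \int[nu]_x (ln (a1 x))%:E.
  rewrite -integral_ge0N; last by move=> x _; rewrite lee_fin oppr_ge0.
  by apply: eq_integral => x _; rewrite -EFinN opprK.
have fin : \int[nu]_x (- ln (a1 x))%:E \is a fin_num.
  by apply: integrable_fin_num => //; exact: (integrableN ia1).
rewrite fin_num_oppeD// !expeRD muleCA [RHS]muleC; congr (_ * _).
exact: muleC.
Qed.

Lemma pushforward_mult_density a : pos_log_summable a ->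
  forall B, measurable B ->
    P (mult a @^-1` B) = \int[P]_(eta in B) mult_density nu a eta.
Proof. by move=> sa; apply: mult_density_of_laplace => // f; exact: laplace_tilde. Qed.

End gamma_quasi_invariance.

Section zero_set.
Context (R : realType) d (X : measurableType d).
Local Notation D := (dmeasure R X).
Implicit Types (a b : X -> R) (eta : D).

Lemma dmeasure_eq (eta eta' : D) : mass eta = mass eta' -> eta = eta'.
Proof.
case: eta eta' => m s [m' s'] /= mm'; rewrite mm' in s *.
by congr DMeasure; exact: Prop_irrelevance.
Qed.

Lemma multdom_congr a b eta : (forall x, a x * mass eta x = b x * mass eta x)%R ->
  multdom a eta = multdom b eta.
Proof.
move=> ab; rewrite /multdom /=; congr (summable _ (EFin \o _)).
by apply/funext => x; exact: ab.
Qed.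

Lemma mult_congr a b eta : (forall x, a x * mass eta x = b x * mass eta x)%R ->
  mult a eta = mult b eta.
Proof.
move=> ab; have dab := multdom_congr ab.
rewrite /mult; case: pselect => ha; case: pselect => hb //.
- by apply: dmeasure_eq; apply/funext => x; exact: ab.
- by case: hb; rewrite -dab.
- by case: ha; rewrite dab.
Qed.

Lemma dint_congr a b eta : (forall x, a x * mass eta x = b x * mass eta x)%R ->
  dint eta a = dint eta b.
Proof. by move=> ab; rewrite /dint; congr rsum; apply/funext => x; exact: ab. Qed.

End zero_set.

Theorem theorem3 (R : realType) (d : measure_display) (X : measurableType d)
    (nu : {finite_measure set X -> \bar R})
    (P : probability (dmeasure R X) R) (a : X -> R)
    (X_standard : standard_borel R X) (nu_nonatomic : nonatomic nu)
    (P_gamma : gamma_measure nu P) (a_log : log_summable nu a) :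
  [/\ {ae P, forall eta, multdom a eta},
      measurable_fun [set: dmeasure R X] (mult a),
      pushforward P (mult a) `<< P,
      P `<< pushforward P (mult a) &
      has_density (pushforward P (mult a)) P (mult_density nu a)].
Proof.
have [ma a0 ia] := a_log; have Ppos := P_gamma.1.
pose N := a @^-1` [set 0%R].
have mN : measurable N.
  by rewrite -[X in measurable X]setTI; apply: ma.
have nuN : nu N = 0.
  apply/negligibleP => //; have := integrable_ae measurableT ia.
  apply: negligibleS => x /= ax /(_ I); rewrite /N ax.
  by rewrite /lne lexx.
(* Replacing a by 1 on its zero set N changes neither side almost surely,
   because almost every discrete measure has no mass on N. *)
pose b x := if a x == 0%R then 1%R else a x.
have bE x : ~ N x -> b x = a x by rewrite /N /b /=; case: eqP.
have b0 x : (0 < b x)%R.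
  by rewrite /b; case: eqP => // /eqP ax; rewrite lt_neqAle eq_sym ax a0.
have mb : measurable_fun [set: X] b.
  apply: measurable_fun_ifT => //.
  by apply: measurable_fun_eqr.
have lb : pos_log_summable nu b.
  split => //; apply: (le_integrable measurableT _ _ ia).
    by apply/measurable_EFinP; apply: measurableT_comp mb; exact: measurable_ln.
  move=> x _; have := b0 x; rewrite /b; case: eqP => [-> _|_ ax].
    by rewrite ln1 abse0 abse_ge0.
  by rewrite lne_EFin.
have null : {ae P, forall eta, forall x, N x -> mass eta x = 0%R}.
  exact: (ae_null X_standard P_gamma).
have prod_ae (u v : X -> R) : (forall x, ~ N x -> u x = v x) ->
    {ae P, forall eta, forall x, (u x * mass eta x = v x * mass eta x)%R}.
  move=> uv; apply: (filterS _ null) => eta eN x.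
  by have [Nx|/uv ->//] := pselect (N x); rewrite (eN x Nx) !mulr0.
have ab_ae := prod_ae a b (fun x Nx => esym (bE x Nx)).
have tilde_ae : {ae P, forall eta, forall x,
    (tilde a x * mass eta x = tilde b x * mass eta x)%R}.
  by apply: prod_ae => x Nx; rewrite /tilde bE.
have densE : {ae P, forall eta, mult_density nu a eta = mult_density nu b eta}.
  apply: (filterS _ tilde_ae) => eta ab.
  rewrite /mult_density (dint_congr ab); congr (expeR (- _) * _).
  apply: ae_eq_integral => //; first exact: measurable_int ia.
    rewrite (_ : (fun x => _) = fun x => (ln (b x))%:E); last first.
      by apply/funext => x; rewrite lne_EFin.
    by have [_ _ /measurable_int] := lb.
  exists N; split => // x /= /not_implyP[_ abx]; apply: contrapT => Nx.
  by apply: abx; rewrite bE.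
have dens_gt0 : {ae P, forall eta, 0 < mult_density nu a eta}.
  have [_ _ ib] := lb; have mV := measurableT_comp (@measurable_invr R) mb.
  have V0 x : (0 <= (b x)^-1)%R by rewrite invr_ge0 ltW.
  have mt : measurable_fun [set: X] (tilde b) by exact: measurable_funB.
  have one_fin (eta : dmeasure R X) : dpositive eta -> dint eta (cst 1%R) < +oo.
    by move=> pe; apply: (@dint_lty _ _ _ _ _ 1%R).
  have Voo := ae_dint_log_summable X_standard P_gamma (pos_log_summableV lb).
  apply: filterS3 Ppos densE Voo => eta pe -> Voo_eta.
  rewrite mult_densityE//; apply: mule_gt0; apply: expeR_gt0.
    by rewrite lteNr; exact: integrable_lty.
  rewrite lteNr; apply: le_lt_trans Voo_eta.
  rewrite (_ : tilde b = (fun x => (b x)^-1) \- cst 1)%R// dintB//; last exact: one_fin.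
  by rewrite geeDl// oppe_le0 dint_ge0.
have m_mult : measurable_fun [set: dmeasure R X] (mult a) by exact: measurable_mult.
have mda := measurable_mult_density nu X_standard ma.
have dens B : measurable B ->
    pushforward P (mult a) B = \int[P]_(eta in B) mult_density nu a eta.
  move=> mB; have mBa : measurable (mult a @^-1` B).
    by rewrite -[X in measurable X]setTI; apply: m_mult.
  have mBb : measurable (mult b @^-1` B).
    by rewrite -[X in measurable X]setTI; apply: (measurable_mult X_standard mb).
  transitivity (P (mult b @^-1` B)).
    rewrite /pushforward -(setIT (mult a @^-1` B)) -(setIT (mult b @^-1` B)).
    rewrite -!integral_indic//; apply: ge0_ae_eq_integral => //.
    - by apply/measurable_EFinP; exact: measurable_indic.
    - by apply/measurable_EFinP; exact: measurable_indic.
    apply: (filterS _ ab_ae) => eta ab _; rewrite !indicE.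
    suff -> : (eta \in mult a @^-1` B) = (eta \in mult b @^-1` B) by [].
    by apply/idP/idP; rewrite !inE /= (mult_congr ab).
  rewrite (pushforward_mult_density X_standard P_gamma lb mB).
  apply: ge0_ae_eq_integral => //.
  - by apply: measurable_funTS; exact: measurable_mult_density.
  - exact: measurable_funTS.
  - by move=> eta _; exact: mult_density_ge0.
  - by move=> eta _; exact: mult_density_ge0.
  - by apply: (filterS _ densE) => eta -> _.
split => //.
- apply: filterS2 ab_ae (ae_multdom X_standard P_gamma lb) => eta ab.
  by rewrite (multdom_congr ab).
- apply/null_content_dominatesP => B mB PB0; rewrite dens//.
  by apply: null_set_integral => //; exact: measurable_funTS.
- move=> C C0 B mB BC; have := C0 B mB BC; rewrite dens// => B0.
  have /(ae_eq_integral_abs _ mB _).1 : \int[P]_(eta in B) `|mult_density nu a eta| = 0.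
    by under eq_integral do rewrite gee0_abs ?mult_density_ge0//.
  have mdB : measurable_fun B (mult_density nu a) by exact: measurable_funTS.
  move=> /(_ mdB) dens_eq0.
  have : {ae P, forall eta, ~ B eta}.
    apply: filterS2 dens_eq0 dens_gt0 => eta e0 gt0 Beta.
    by have := gt0; rewrite e0// ltxx.
  move=> nB; apply/(@negligibleP _ _ _ P) => //.
  by apply: negligibleS nB => eta Beta /(_ Beta).
- by split=> // eta; exact: mult_density_ge0.
Qed.
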